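(* Let $P$ be a connected link diagram in the plane, let $\langle P\rangle\in\mathbb{Z}[A,A^{-1}]$ be its Kauffman bracket, and let $\mathbb{D}$ be the oriented ribbon graph associated to the all-$A$-splicing of $P$. Let $e(\mathbb{D})$ and $v(\mathbb{D})$ be the numbers of edges and vertices of $\mathbb{D}$, let $C(\mathbb{D};X,Y,Z)\in\mathbb{Z}[X,Y,Z]$ be the Bollobás–Riordan–Tutte polynomial of $\mathbb{D}$, and put $\delta:=-A^2-A^{-2}$. Then $$A^{-e(\mathbb{D})}\,\langle P\rangle = A^{2-2v(\mathbb{D})}\; C(\mathbb{D};\,-A^4,\;A^{-2}\delta,\;\delta^{-2}).$$
   Context: Oriented ribbon graphs. A connected oriented ribbon graph is a triple $\mathbb{D}=(\sigma_0,\sigma_1,\sigma_2)$ of permutations of a finite set $\mathcal{B}$ with $2n$ elements (half-edges) such that $\sigma_1$ is a fixed-point-free involution, $\sigma_0(\sigma_1(\sigma_2(b)))=b$ for all $b$, and $\langle\sigma_0,\sigma_1\rangle$ acts transitively on $\mathcal{B}$. The empty set of half-edges is also allowed; that ribbon graph has one vertex, no edges and one face. An oriented ribbon graph is a disjoint union of connected ones. Vertices, edges, faces are the orbits of $\sigma_0,\sigma_1,\sigma_2$ respectively (each component without half-edges contributes one vertex and one face); an edge joins the vertices containing its two half-edges, and is a loop if these coincide. Write $v,e,f,k$ for the numbers of vertices, edges, faces, connected components; the genus is $g(\mathbb{D})=\frac{2k(\mathbb{D})-v(\mathbb{D})+e(\mathbb{D})-f(\mathbb{D})}{2}$ and the nullity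 is $n(\mathbb{D})=e(\mathbb{D})-v(\mathbb{D})+k(\mathbb{D})$. Deletion and contraction. $\mathbb{D}-e$ is obtained by omitting both half-edges of $e$ from the cyclic orders at the vertices (vertices are kept, possibly becoming isolated). For a non-loop edge $e=\{h,h'\}$ with vertex cycles $(h\,a_1\dots a_r)$ and $(h'\,b_1\dots b_s)$, the ribbon graph $\mathbb{D}/e$ is obtained by replacing these two vertices by one with cycle $(a_1\dots a_r\,b_1\dots b_s)$. A bridge is an edge whose deletion increases the number of components by 1. A spanning subgraph $\mathbb{H}\subset\mathbb{D}$ is a ribbon graph on the same vertex set obtained by deleting a subset of edges. Bollobás–Riordan–Tutte polynomial. It is the (well-defined, by a theorem of Bollobás and Riordan) invariant of connected oriented ribbon graphs determined by: $C(\mathbb{D})=C(\mathbb{D}-e)+C(\mathbb{D}/e)$ if $e$ is neither a bridge nor a loop; $C(\mathbb{D})=X\,C(\mathbb{D}/e)$ if $e$ is a bridge; and $C(\mathbb{D})=\sum_{\mathbb{H}\subset\mathbb{D}}Y^{n(\mathbb{H})}Z^{g(\mathbb{H})}$ (sum over all $2^{e(\mathbb{D})}$ spanning subgraphs) if $\mathbb{D}$ has one vertex. Link diagrams. A diagram is connected if its underlying planar 4-valent graph (with crossings as vertices, or a single circle if there are no crossings) is connected. At a crossing, the $A$-splicing is the smoothing that joins the two local regions swept out by rotating the over-strand counterclockwise until it meets the under-strand; the $B$-splicing is the other smoothing. The Kauffman bracket is determined by $\langle\bigcirc\rangle=1$, $\langle L\sqcup\bigcirc\rangle=\delta\langle L\rangle$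 with $\delta=-A^2-A^{-2}$, and $\langle L\rangle=A\langle L_A\rangle+A^{-1}\langle L_B\rangle$, where $L_A,L_B$ are the results of $A$- and $B$-splicing a chosen crossing. Ribbon graph of the all-$A$-splicing. Perform the $A$-splicing at every crossing, obtaining disjoint circles in the plane together with, for each crossing, an embedded arc joining the two spliced strands. Orient each circle clockwise or anticlockwise according to whether it lies inside an odd or even number of the other circles. The half-edges are pairs $(C,\gamma)$ where $C$ is a circle and $\gamma$ is a directed splicing arc starting on $C$. The permutation $\sigma_0$ sends a half-edge to the next one met along $C$ in the direction of its orientation, $\sigma_1$ sends a directed arc to the oppositely directed arc, and $\sigma_2$ is determined by $\sigma_0\sigma_1\sigma_2=1$. Thus vertices are the circles and edges are the crossings. *)

(* Defs.v *)
From HB Require Import structures.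
From mathcomp Require Import all_boot all_order all_algebra all_fingroup.
From mathcomp Require Import mpoly.
From Stdlib Require Import ClassicalEpsilon.

Set Implicit Arguments.
Unset Strict Implicit.
Unset Printing Implicit Defensive.

Import GRing.Theory.
Local Open Scope ring_scope.

Section Induced.

Variables (T : finType) (K : {set T}) (s : {perm T}).
Implicit Types x y : T.

(* Every element outside K is omitted from the cyclic order given by the cycle
   of s that contains it, and becomes a fixed point. *)
Definition induced_fun x : T :=
  next [seq y <- fingraph.orbit s x | y \in K] x.

Lemma induced_fun_out x : x \notin K -> induced_fun x = x.
Proof. by move=> xK; rewrite /induced_fun next_nth mem_filter (negPf xK). Qed.

Lemma induced_cycle x : x \in K ->
  [/\ x \in [seq y <- fingraph.orbit s x | y \in K],
      uniq [seq y <- fingraph.orbit s x | y \in K]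
    & induced_fun x \in [seq y <- fingraph.orbit s x | y \in K]].
Proof.
move=> xK; have xf : x \in [seq y <- fingraph.orbit s x | y \in K].
  by rewrite mem_filter xK in_orbit.
by rewrite xf /induced_fun mem_next xf filter_uniq ?orbit_uniq.
Qed.

Lemma induced_fun_in x : x \in K -> induced_fun x \in K.
Proof. by case/induced_cycle=> _ _; rewrite mem_filter => /andP[]. Qed.

Lemma induced_fun_orbit x y : x \in K ->
    y \in [seq z <- fingraph.orbit s x | z \in K] ->
  induced_fun y = next [seq z <- fingraph.orbit s x | z \in K] y.
Proof.
move=> xK; rewrite mem_filter => /andP[yK ys].
have [_ ux _] := induced_cycle xK.
have cyc := cycle_orbit (@perm_inj _ s) x.
rewrite /induced_fun; have [i ->] := orbit_rot_cycle cyc (orbit_uniq s x) ys.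
move: ux; rewrite -[in uniq _](cat_take_drop i (fingraph.orbit s x)).
rewrite -[in RHS](cat_take_drop i (fingraph.orbit s x)) /rot !filter_cat => ux.
by rewrite -rot_size_cat next_rot.
Qed.

Lemma induced_fun_inj : injective induced_fun.
Proof.
have out x y : x \notin K -> induced_fun x = induced_fun y -> x = y.
  move=> xK; rewrite (induced_fun_out xK) => xy.
  have [yK|yK] := boolP (y \in K); last by rewrite xy induced_fun_out.
  by rewrite xy induced_fun_in in xK.
move=> x y xy; have [xK|xK] := boolP (x \in K); last exact: out.
have [yK|yK] := boolP (y \in K); last exact/esym/(out y x).
have [xf ux nx] := induced_cycle xK; have [yf _ ny] := induced_cycle yK.
have yx : y \in [seq z <- fingraph.orbit s x | z \in K].
  move: nx; rewrite xy !mem_filter yK /= => /andP[_].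
  move: ny; rewrite mem_filter => /andP[_].
  rewrite -!fconnect_orbit => yn xn.
  by rewrite (connect_trans xn) // (fconnect_sym (@perm_inj _ s)).
apply: (can_inj (prev_next ux)).
by rewrite -(induced_fun_orbit xK xf) xy (induced_fun_orbit xK yx).
Qed.

Lemma induced_fun_first x : x \in K -> exists2 m, (0 < m)%N &
  induced_fun x = iter m s x /\
  (forall j, (0 < j < m)%N -> iter j s x \notin K).
Proof.
move=> xK; have first y n : let p := [seq z <- traject s y n | z \in K] in
     (p = [::] /\ forall j, (j < n)%N -> iter j s y \notin K)
  \/ exists m q, p = iter m s y :: q /\
        forall j, (j < m)%N -> iter j s y \notin K.
  elim: n y => [|n IHn] y /=; first by left.
  have [yK|yK] := boolP (y \in K); first by right; exists 0%N; eexists.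
  have [[-> out]|[m [q [-> out]]]] := IHn (s y).
    by left; split=> // -[|j] // /out; rewrite -iterSr.
  right; exists m.+1, q; rewrite iterSr; split=> // -[|j] // /out.
  by rewrite -iterSr.
have sx : iter (fingraph.order s x) s x = x by apply: iter_order; exact: perm_inj.
rewrite /induced_fun /fingraph.orbit -orderSpred /= xK /=.
have [[-> out]|[m [q [-> out]]]] := first (s x) (fingraph.order s x).-1.
  exists (fingraph.order s x); first by rewrite -orderSpred.
  rewrite /= eqxx sx; split=> // -[|j] //.
  by rewrite -orderSpred ltnS iterSr => /out.
exists m.+1 => //; rewrite /= eqxx -iterSr; split=> // -[|j] //.
by rewrite ltnS iterSr => /out.
Qed.

Definition induced : {perm T} := perm induced_fun_inj.

Lemma induced_on : perm_on K induced.
Proof.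
apply/subsetP=> x; rewrite inE permE; apply: contraNT => xK.
by rewrite induced_fun_out.
Qed.

End Induced.

(* [isolated] is the number of connected components without half-edges. *)
Record ribbon (T : finType) := Ribbon {
  half_edges : {set T};
  sigma0 : {perm T};
  sigma1 : {perm T};
  isolated : nat;
  ribbonP : [&& perm_on half_edges sigma0, perm_on half_edges sigma1,
    [forall b, sigma1 (sigma1 b) == b] &
    [forall b in half_edges, sigma1 b != b]]
}.

Section RibbonGraph.

Variable T : finType.
Implicit Types (D : ribbon T) (h : T) (E : {set {set T}}).

(* Products in {perm T} are composed from left to right, so that
   (sigma1 * sigma0) b = sigma0 (sigma1 b). *)
Definition sigma2 D : {perm T} := ((sigma1 D * sigma0 D)^-1)%g.

Lemma sigma012 D b : sigma0 D (sigma1 D (sigma2 D b)) = b.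
Proof. by rewrite -permM /sigma2 permKV. Qed.

Definition edge_of D h : {set T} := porbit (sigma1 D) h.

Definition edges D : {set {set T}} := edge_of D @: half_edges D.

Definition num_vertices D : nat :=
  (#|porbit (sigma0 D) @: half_edges D| + isolated D)%N.

Definition num_edges D : nat := #|edges D|.

Definition num_faces D : nat :=
  (#|porbit (sigma2 D) @: half_edges D| + isolated D)%N.

Definition num_components D : nat :=
  (#|orbit 'P <<[set sigma0 D; sigma1 D]>>%g @: half_edges D| + isolated D)%N.

Definition ribbon_connected D : bool := num_components D == 1%N.

(* 2k + e >= v + f and e + k >= v hold for every ribbon graph, and
   2k - v + e - f is even. *)
Definition genus D : nat :=
  ((2 * num_components D + num_edges D) - (num_vertices D + num_faces D))./2%N.

Definition nullity D : nat :=
  ((num_edges D + num_components D) - num_vertices D)%N.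

Definition is_loop D h : bool := sigma1 D h \in porbit (sigma0 D) h.

Definition kept D E : {set T} := [set x in half_edges D | edge_of D x \notin E].

Lemma delete_subproof D E :
  [&& perm_on (kept D E) (induced (kept D E) (sigma0 D)),
      perm_on (kept D E) (restr_perm (kept D E) (sigma1 D)),
      [forall b, restr_perm (kept D E) (sigma1 D)
                   (restr_perm (kept D E) (sigma1 D) b) == b] &
      [forall b in kept D E, restr_perm (kept D E) (sigma1 D) b != b]].
Proof.
have /and4P[_ on1 /forallP inv1 /forallP fix1] := ribbonP D.
have s1K : sigma1 D \in 'N(kept D E | 'P)%g.
  rewrite !inE /=; apply/subsetP=> x; rewrite !inE apermE (perm_closed _ on1).
  by rewrite /edge_of (porbit_perm _ 1 x).
rewrite induced_on restr_perm_on /=; apply/andP; split; apply/forallP=> b.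
  have [bK|bK] := boolP (b \in kept D E).
    rewrite [X in restr_perm _ _ X]restr_permE // restr_permE //.
    by have := astabs_act b s1K; rewrite /= apermE => ->.
  by rewrite !(out_perm (restr_perm_on _ _) bK).
apply/implyP=> bK; rewrite restr_permE //.
by move: bK (fix1 b); rewrite inE => /andP[-> _].
Qed.

(* The ribbon graph D - E on the same vertex set: the vertices all of whose
   half-edges are omitted become isolated. *)
Definition delete D E : ribbon T :=
  @Ribbon T (kept D E) (induced (kept D E) (sigma0 D))
    (restr_perm (kept D E) (sigma1 D))
    (isolated D + #|[set v in porbit (sigma0 D) @: half_edges D |
                       [disjoint v & kept D E]]|)
    (delete_subproof D E).

Lemma join_subproof D h :
  [&& perm_on (half_edges D) (sigma0 D * tperm h (sigma1 D h))%g,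
      perm_on (half_edges D) (sigma1 D),
      [forall b, sigma1 D (sigma1 D b) == b] &
      [forall b in half_edges D, sigma1 D b != b]].
Proof.
have /and4P[on0 on1 -> ->] := ribbonP D; rewrite on1 !andbT.
rewrite perm_onM //; have [hD|hD] := boolP (h \in half_edges D).
  apply: subset_trans (tperm_on _ _) _; apply/subsetP=> x.
  by rewrite !inE => /orP[] /eqP-> //; rewrite perm_closed.
by rewrite (out_perm on1 hD) tperm1 perm_on1.
Qed.

(* For h' = sigma1 h on another vertex than h, the cycles (h a1 ... ar) and
   (h' b1 ... bs) of sigma0 are joined into (h a1 ... ar h' b1 ... bs). *)
Definition join D h : ribbon T :=
  @Ribbon T (half_edges D) (sigma0 D * tperm h (sigma1 D h))%g (sigma1 D)
    (isolated D) (join_subproof D h).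

Definition contract D h : ribbon T := delete (join D h) [set edge_of D h].

Definition is_bridge D h : bool :=
  num_components (delete D [set edge_of D h]) == (num_components D).+1.

End RibbonGraph.

Definition ribbon_isomorphic (T T' : finType) (D : ribbon T) (D' : ribbon T') :
    Prop :=
  exists f : T -> T',
    [/\ {in half_edges D &, injective f},
        f @: half_edges D = half_edges D',
        {in half_edges D, forall b, f (sigma0 D b) = sigma0 D' (f b)},
        {in half_edges D, forall b, f (sigma1 D b) = sigma1 D' (f b)}
      & isolated D = isolated D'].

Definition X3 : 'I_3 := @Ordinal 3 0 isT.
Definition Y3 : 'I_3 := @Ordinal 3 1 isT.
Definition Z3 : 'I_3 := @Ordinal 3 2 isT.

Record is_BRT (C : forall T : finType, ribbon T -> {mpoly int[3]}) : Prop := {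
  BRT_invariant (T T' : finType) (D : ribbon T) (D' : ribbon T') :
    ribbon_connected D -> ribbon_isomorphic D D' -> C T D = C T' D';
  BRT_delete_contract (T : finType) (D : ribbon T) (h : T) :
    ribbon_connected D -> h \in half_edges D ->
    ~~ is_bridge D h -> ~~ is_loop D h ->
    C T D = C T (delete D [set edge_of D h]) + C T (contract D h);
  BRT_bridge (T : finType) (D : ribbon T) (h : T) :
    ribbon_connected D -> h \in half_edges D -> is_bridge D h ->
    C T D = 'X_X3 * C T (contract D h);
  BRT_one_vertex (T : finType) (D : ribbon T) :
    ribbon_connected D -> num_vertices D = 1%N ->
    C T D = \sum_(E : {set {set T}} | E \subset edges D)
              'X_Y3 ^+ nullity (delete D E) * 'X_Z3 ^+ genus (delete D E)
}.

(* The properties above determine the polynomial of every connected ribbon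
   graph; its values on disconnected ones are irrelevant. *)
Definition BRT : forall T : finType, ribbon T -> {mpoly int[3]} :=
  epsilon (inhabits (fun _ _ => 0)) is_BRT.

Arguments BRT {T} D.

(* The dart (c, i) is the i-th end, in counterclockwise order, of the four
   ends of strands at the crossing c; the ends 0 and 2 belong to the
   over-strand.  The involution [tau] exchanges the two ends of each arc of the
   underlying 4-valent graph, and [circles] counts the components without
   crossings.  The planarity of the diagram is a separate condition. *)
Definition darts (X : finType) (N : {set X}) : {set X * 'I_4} :=
  [set d | d.1 \in N].

Record diagram (X : finType) := Diagram {
  crossings : {set X};
  tau : {perm X * 'I_4};
  circles : nat;
  diagramP : [&& perm_on (darts crossings) tau,
    [forall d, tau (tau d) == d] &
    [forall d in darts crossings, tau d != d]]
}.

(* The strands left by the A-splicing join the end 0 to 3 and 1 to 2, those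
   left by the B-splicing join 0 to 1 and 2 to 3: the over-strand, rotated
   counterclockwise, sweeps out the corners (0, 1) and (2, 3). *)
Inductive splicing := ASplicing | BSplicing.

Definition partner (sp : splicing) (i : 'I_4) : 'I_4 :=
  match sp with
  | ASplicing => rev_ord i
  | BSplicing => rev_ord (ordS (ordS i))
  end.

Lemma partnerK sp : involutive (partner sp).
Proof. by move=> i; apply/val_inj; case: sp; case: i => -[|[|[|[|]]]]. Qed.

Lemma partner_neq sp i : partner sp i != i.
Proof. by case: sp; case: i => -[|[|[|[|]]]]. Qed.

Section Splicing.

Variable X : finType.
Implicit Types (N : {set X}) (c : X) (D : diagram X) (d : X * 'I_4).

Definition strand_fun sp N d : X * 'I_4 :=
  if d.1 \in N then (d.1, partner sp d.2) else d.

Lemma strand_funK sp N : involutive (strand_fun sp N).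
Proof.
move=> [c i]; rewrite /strand_fun; case cN: (c \in N) => /=; rewrite ?cN //.
by rewrite partnerK.
Qed.

(* The other end of the strand at d, once the crossings in N are spliced. *)
Definition strand sp N : {perm X * 'I_4} := perm (inv_inj (strand_funK sp N)).

(* Follow the arc at a dart and, if its other end is at c, go on along the
   spliced strand there. *)
Definition walk sp D c : {perm X * 'I_4} := (tau D * strand sp [set c])%g.

Definition spliced_crossings D c := crossings D :\ c.

Definition spliced_tau sp D c : {perm X * 'I_4} :=
  induced (darts (spliced_crossings D c)) (walk sp D c).

Definition new_circles sp D c : {set {set X * 'I_4}} :=
  [set O in [set orbit 'P <<[set tau D; strand sp [set c]]>>%g d
              | d in darts [set c]] | O \subset darts [set c]].

Lemma splice_subproof sp D c :
  [&& perm_on (darts (spliced_crossings D c)) (spliced_tau sp D c),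
      [forall d, spliced_tau sp D c (spliced_tau sp D c d) == d] &
      [forall d in darts (spliced_crossings D c), spliced_tau sp D c d != d]].
Proof.
rewrite induced_on /=; have /and3P[ont /forallP tauK /forallP tau_neq] := diagramP D.
set N := crossings D in ont tau_neq *; set K := darts _.
set r := walk sp D c; set p := strand sp [set c].
have rE d : r d = p (tau D d) by rewrite permM.
have pK d : p (p d) = d by rewrite !permE strand_funK.
have p1 d : (p d).1 = d.1 by rewrite permE /strand_fun; case: ifP.
have p_id d : d \in K -> p d = d.
  by rewrite !inE permE /strand_fun inE => /andP[/negPf->].
have p_in d : (p d \in K) = (d \in K) by rewrite !inE p1.
have iter_p j d : iter j r (p (iter j r d)) = p d.
  elim: j d => // j IHj d; rewrite iterSr [iter j.+1 r d]/= rE rE pK.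
  by rewrite (eqP (tauK _)) IHj.
have iter_N j d : d \in darts N -> iter j r d \in darts N.
  move=> dN; elim: j => //= j; rewrite !inE rE p1.
  by have := perm_closed (iter j r d) ont; rewrite !inE => ->.
have back m x j : iter m r x \in K -> (j <= m)%N ->
    iter j r (iter m r x) = p (iter (m - j) r x).
  move=> yK jm; rewrite -[in LHS](p_id _ yK) -(subnKC jm) iterD iter_p.
  by rewrite addKn.
have KN d : d \in K -> d \in darts N by rewrite !inE => /andP[].
apply/andP; split; apply/forallP=> x.
  have [xK|xK] := boolP (x \in K); last first.
    by rewrite !permE !induced_fun_out.
  have yK := induced_fun_in r xK.
  have [m m_gt0 [ym out]] := induced_fun_first r xK.
  have [m' m'_gt0 [zm out']] := induced_fun_first r yK.
  have zK := induced_fun_in r yK; rewrite !permE; apply/eqP.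
  rewrite zm ym back // -?ym //; last first.
    rewrite leqNgt; apply/negP=> mm'; have := out' m; rewrite m_gt0 mm'.
    by move=> /(_ isT); rewrite ym back -?ym // subnn p_id xK.
  have [m'm|m'm|->] := ltngtP m' m.
  - have := out (m - m')%N; rewrite subn_gt0 m'm ltn_subrL m'_gt0 m_gt0.
    move=> /(_ isT); rewrite -p_in -back -?ym //; last exact: ltnW.
    by rewrite -zm zK.
  - have := out' m; rewrite m_gt0 m'm => /(_ isT).
    by rewrite ym back -?ym // subnn p_id xK.
  - by rewrite subnn p_id.
apply/implyP=> xK; rewrite permE; apply/eqP=> Fx.
have [m m_gt0 [ym out]] := induced_fun_first r xK.
have {Fx}xm : iter m r x = x by rewrite -ym.
have bk j : (j <= m)%N -> iter j r x = p (iter (m - j) r x).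
  by move=> jm; rewrite -back ?xm.
have := odd_double_half m; case: (odd m) => /= mE.
  have /bk : ((m./2).+1 <= m)%N by rewrite -{2}mE add1n -addnn ltnS leq_addl.
  rewrite -{2}mE add1n -addnn subSS addnK [iter _.+1 _ _]/= rE => /perm_inj.
  by apply/eqP; apply: (implyP (tau_neq _)); apply/iter_N/KN.
have k_gt0 : (0 < m./2)%N by rewrite -double_gt0 -[_.*2]add0n mE.
have km : (m./2 < m)%N by rewrite -{2}mE add0n -addnn -[X in (X < _)%N]addn0 ltn_add2l.
have := out _; move=> /(_ m./2); rewrite k_gt0 km => /(_ isT).
have /bk := ltnW km; rewrite -{2}mE add0n -addnn addnK.
set z := iter _ r x => pz zK; have zN : z \in darts N by apply/iter_N/KN.
move: zK pz; rewrite !inE in zN *; rewrite zN andbT negbK => /eqP zc.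
rewrite permE /strand_fun inE zc eqxx => /(congr1 snd) /= /esym/eqP.
by rewrite (negPf (partner_neq _ _)).
Qed.

(* Circles that run only through darts at c and the spliced strands there
   become components without crossings. *)
Definition splice sp D c : diagram X :=
  @Diagram X (spliced_crossings D c) (spliced_tau sp D c)
    (circles D + #|new_circles sp D c|) (splice_subproof sp D c).

Definition add_circle D : diagram X :=
  @Diagram X (crossings D) (tau D) (circles D).+1 (diagramP D).

End Splicing.

(* Z[A, 1/A] is a subring of the field of fractions of Z[A]; the latter also
   contains the inverse of delta. *)
Definition ratfun : fieldType := {fraction {poly int}}.

Definition varA : ratfun := tofrac 'X.

Definition delta : ratfun := - varA ^+ 2 - varA ^- 2.

Record is_bracket (br : forall X : finType, diagram X -> ratfun) : Prop := {
  bracket_circle (X : finType) (L : diagram X) :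
    crossings L = set0 -> circles L = 1%N -> br X L = 1;
  bracket_add_circle (X : finType) (L : diagram X) :
    (0 < #|crossings L| + circles L)%N ->
    br X (add_circle L) = delta * br X L;
  bracket_splice (X : finType) (L : diagram X) (c : X) :
    c \in crossings L ->
    br X L =
      varA * br X (splice ASplicing L c) + varA^-1 * br X (splice BSplicing L c)
}.

Definition bracket : forall X : finType, diagram X -> ratfun :=
  epsilon (inhabits (fun _ _ => 0)) is_bracket.

Arguments bracket {X} D.

Section PlaneDiagram.

Variable X : finType.
Implicit Types (D : diagram X) (outer C : {set X * 'I_4}) (d : X * 'I_4).

Definition rot_fun d : X * 'I_4 := (d.1, ordS d.2).

Lemma rot_fun_inj : injective rot_fun.
Proof.
move=> [c i] [c' i'] /eqP; rewrite xpair_eqE /= => /andP[/eqP-> /eqP].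
by move/ordS_inj->.
Qed.

Definition rotation : {perm X * 'I_4} := perm rot_fun_inj.

(* A dart d stands also for the corner between d and rotation d, which belongs
   to the face on the left of d when leaving the crossing along d.  The next
   corner along the boundary of this face is rotation^-1 (tau D d). *)
Definition face_perm D : {perm X * 'I_4} := (tau D * rotation^-1)%g.

Definition faces D : {set {set X * 'I_4}} :=
  porbit (face_perm D) @: darts (crossings D).

Definition arcs D : {set {set X * 'I_4}} :=
  porbit (tau D) @: darts (crossings D).

Definition diagram_components D : nat :=
  (#|orbit 'P <<[set tau D; rotation]>>%g @: darts (crossings D)| + circles D)%N.

Definition diagram_connected D : bool := diagram_components D == 1%N.

(* Euler's formula, each component being drawn on its own sphere; a circle
   without crossings has two faces there, and no contribution to the numbers of
   vertices and arcs. *)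
Definition planar D : bool :=
  (#|crossings D| + (#|faces D| + 2 * circles D) ==
   #|arcs D| + 2 * diagram_components D)%N.

(* A connected diagram on the sphere becomes one in the plane by the choice of
   the unbounded face, given here by its set of corners.  A single circle has
   no corner, and no choice is needed. *)
Definition connected_plane_diagram D outer : bool :=
  [&& diagram_connected D, planar D &
      (crossings D != set0) ==> (outer \in faces D)].

End PlaneDiagram.

Arguments rotation {X}.

Section AllA.

Variables (X : finType) (D : diagram X) (outer : {set X * 'I_4}).
Implicit Types (C : {set X * 'I_4}) (d : X * 'I_4) (h : X * bool).

(* The circle of the all-A-splicing through d, as a set of darts. *)
Definition circle_of d : {set X * 'I_4} :=
  orbit 'P <<[set tau D; strand ASplicing (crossings D)]>>%g d.

Definition state_circles : {set {set X * 'I_4}} :=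
  circle_of @: darts (crossings D).

(* One can move between two corners without meeting the circle C: inside a
   face, across an arc that is not on C, or between the two corners joined by
   the A-splicing of a crossing. *)
Definition off_circle C : rel (X * 'I_4) := fun d d' =>
  [|| d' == face_perm D d,
      (d \notin C) && (d' == tau D d)
    | ~~ odd d.2 && (d' == rotation (rotation d))].

Definition inside C d : bool :=
  ~~ [exists d' in outer, connect (off_circle C) d d'].

Definition lies_inside C C' : bool := [forall d in C, inside C' d].

Definition depth C : nat :=
  #|[set C' in state_circles | (C' != C) && lies_inside C C']|.

(* The orientation of the circle through d leaves the crossing along d: the
   inner side of the circle is on the left of d if the circle is oriented
   anticlockwise, and on the right otherwise. *)
Definition outgoing d : bool :=
  inside (circle_of d) d (+) odd (depth (circle_of d)).

(* The half-edge (c, b) is the directed splicing arc at c that starts on the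
   strand joining the ends 1 and 2 if b, and on the strand joining the ends 0
   and 3 otherwise. *)
Definition half_edge_at d : X * bool := (d.1, d.2 \in [:: 1; 2]).

Definition exit_dart h : X * 'I_4 :=
  let d := (h.1, if h.2 then 1 else 0) in
  if outgoing d then d else strand ASplicing (crossings D) d.

Definition next_half_edge h : X * bool :=
  if h.1 \in crossings D then half_edge_at (tau D (exit_dart h)) else h.

Definition all_A_half_edges : {set X * bool} := [set h | h.1 \in crossings D].

(* [next_half_edge] is injective for a diagram in the plane; the identity is
   used otherwise. *)
Definition all_A_sigma0 : {perm X * bool} :=
  insubd (1%g : {perm X * bool}) [ffun h => next_half_edge h].

Definition opposite h : X * bool := (h.1, h.2 (+) (h.1 \in crossings D)).

Lemma oppositeK : involutive opposite.
Proof. by move=> [c b]; rewrite /opposite /= addbK. Qed.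

Definition all_A_sigma1 : {perm X * bool} := perm (inv_inj oppositeK).

Lemma all_A_subproof :
  [&& perm_on all_A_half_edges all_A_sigma0,
      perm_on all_A_half_edges all_A_sigma1,
      [forall h, all_A_sigma1 (all_A_sigma1 h) == h] &
      [forall h in all_A_half_edges, all_A_sigma1 h != h]].
Proof.
apply/and4P; split.
- rewrite /all_A_sigma0 /insubd; case: insubP => [s _ sE|_]; last exact: perm_on1.
  apply/subsetP=> h; rewrite !inE; apply: contraNT => hN.
  by move: sE; rewrite /= -pvalE => ->; rewrite ffunE /next_half_edge (negPf hN).
- apply/subsetP=> -[c b]; rewrite !inE permE /opposite /=.
  by apply: contraNT => /negPf->; rewrite addbF.
- by apply/forallP=> h; rewrite !permE oppositeK.
apply/forallP=> -[c b]; apply/implyP; rewrite inE permE /opposite /= => ->.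
by rewrite xpair_eqE eqxx addbT; case: b.
Qed.

Definition all_A_ribbon : ribbon (X * bool)%type :=
  @Ribbon _ all_A_half_edges all_A_sigma0 all_A_sigma1 (circles D)
    all_A_subproof.

End AllA.

Definition eval3 (p : {mpoly int[3]}) (x y z : ratfun) : ratfun :=
  (map_mpoly intr p).@[fun i => tnth [tuple x; y; z] i].

(* Main.v *)
Require Import Defs.
From mathcomp Require Import all_boot all_order all_algebra all_fingroup.
From mathcomp Require Import zify ring mpoly.
From Stdlib Require Import ClassicalEpsilon.

Set Implicit Arguments.
Unset Strict Implicit.
Unset Printing Implicit Defensive.

Import GRing.Theory.
Local Open Scope ring_scope.

(** Both sides are sums over the [2^e] states of the diagram, and the equality
    holds term by term.

    The Bollobas-Riordan-Tutte polynomial of a connected ribbon graph [D] is the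
    sum of [(X - 1)^(k - 1) Y^n Z^g] over its spanning subgraphs [H], where [k],
    [n] and [g] are the numbers of components, the nullity and the genus of [H].
    This sum satisfies the rules for deletion and contraction: contracting an
    edge that is not a loop changes neither the components nor the faces of the
    subgraphs that contain it ([brt_weight_contract]), and a subgraph without a
    bridge has one component more than with it ([brt_sum_bridge]).  The rules
    determine the polynomial by induction on the number of edges
    ([is_BRT_unique]).  Likewise the Kauffman bracket is the sum over all states
    of [A^(a - b) delta^(c - 1)], where [a] and [b] are the numbers of A- and
    B-splicings and [c] is the number of circles of the state
    ([bracket_sum_is_bracket], [is_bracket_unique]).

    The state that is B-spliced exactly at the crossings of [S] corresponds to
    the spanning subgraph with the edges [S], and its circles are the faces of
    this subgraph ([num_faces_state]): a circle runs along the boundary of the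
    union of the discs bounded by the circles of the all-A-splicing and of bands
    along the splicing arcs in [S].  For permutations, this needs an orientation
    of the arcs for which every spliced strand, for the A- and the B-splicing
    alike, has an incoming and an outgoing end.  The orientation of the circles
    by the parity of their depth is such an orientation, because it is given by
    a checkerboard colouring of the faces of the diagram ([outgoing_tau],
    [outgoing_rotation]).  This in turn rests on the Jordan curve theorem for
    the circles: a circle passes an even number of ends at every crossing, so
    that by Euler's formula it is the boundary modulo 2 of a set of faces
    ([even_subgraph_bounds], [jordan_separates]).

    Finally [X - 1 = - A^4 - 1 = A^2 delta] turns the term of a spanning
    subgraph into a monomial in [A] and [delta]; as [2 g = 2 k - v + e - f]
    ([ribbon_euler]), the exponent of [delta] is [f - 1] and the components and
    the genus disappear ([weight_identity]). *)

Notation orb a b := (orbit 'P <<[set a; b]>>%g).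

(** * Orbits of two permutations *)

Section Orbits.

Variable T : finType.
Implicit Types (a b s : {perm T}) (x y : T) (H K : {set T}).

Lemma orb_ind a b (P : pred T) x y :
  (forall z, P z -> P (a z)) -> (forall z, P z -> P (b z)) ->
  P x -> y \in orb a b x -> P y.
Proof.
move=> Pa Pb Px /orbitP[g gG <-]; rewrite /= apermE.
have sG : <<[set a; b]>>%g \subset 'N([set z | P z] | 'P)%g.
  rewrite gen_subG; apply/subsetP=> s sab; rewrite !inE /=.
  apply/subsetP=> z; rewrite !inE apermE.
  by case/set2P: sab => ->; [apply: Pa | apply: Pb].
have := astabs_act x (subsetP sG _ gG).
by rewrite /= apermE !inE Px.
Qed.

Lemma orb_refl a b x : x \in orb a b x.
Proof. exact: orbit_refl. Qed.

Lemma orb_l a b x y : (a y \in orb a b x) = (y \in orb a b x).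
Proof. by rewrite (orbit_actr 'P%act) // mem_gen // !inE eqxx. Qed.

Lemma orb_r a b x y : (b y \in orb a b x) = (y \in orb a b x).
Proof. by rewrite (orbit_actr 'P%act) // mem_gen // !inE eqxx orbT. Qed.

Lemma orb_sym a b x y : (x \in orb a b y) = (y \in orb a b x).
Proof. exact: orbit_sym. Qed.

Lemma orb_trans a b x y z :
  x \in orb a b y -> y \in orb a b z -> x \in orb a b z.
Proof. exact: orbit_trans. Qed.

Lemma orb_eqP a b x y : reflect (orb a b x = orb a b y) (x \in orb a b y).
Proof. exact: orbit_eqP. Qed.

Lemma orbE a b x y : (orb a b x == orb a b y) = (x \in orb a b y).
Proof. by apply/eqP/idP=> /orb_eqP. Qed.

Lemma orb_sub a b a' b' x :
  (forall z, a z \in orb a' b' z) -> (forall z, b z \in orb a' b' z) ->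
  orb a b x \subset orb a' b' x.
Proof.
move=> ha hb; apply/subsetP=> y; apply: (@orb_ind _ _ (fun w =>
  w \in orb a' b' x)) => [z zx|z zx|];
  by [exact: orb_trans (ha z) zx | exact: orb_trans (hb z) zx
     | exact: orb_refl].
Qed.

Lemma eq_orb a b a' b' x :
  (forall z, a z \in orb a' b' z) -> (forall z, b z \in orb a' b' z) ->
  (forall z, a' z \in orb a b z) -> (forall z, b' z \in orb a b z) ->
  orb a b x = orb a' b' x.
Proof. by move=> *; apply/eqP; rewrite eqEsubset !orb_sub. Qed.

Lemma porbit_orb s x : porbit s x = orb s s x.
Proof. by rewrite porbitE setUid. Qed.

Lemma mem_porbit1 s x y : (s y \in porbit s x) = (y \in porbit s x).
Proof. by rewrite porbit_orb orb_l. Qed.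

Lemma porbit_ind s (P : pred T) x y :
  (forall z, P z -> P (s z)) -> P x -> y \in porbit s x -> P y.
Proof. by move=> Ps Px; rewrite porbit_orb; apply: orb_ind. Qed.

Lemma porbit_sub_orb a b x : porbit a x \subset orb a b x.
Proof.
by apply/subsetP=> y; apply: (@porbit_ind _ (fun w => w \in orb a b x)) =>
  [z|]; rewrite /= ?orb_l ?orb_refl.
Qed.

Lemma porbit_mul_sub_orb (a b : {perm T}) x : porbit (b * a)%g x \subset orb a
  b x.
Proof.
by rewrite porbit_orb; apply: orb_sub => z; rewrite permM orb_l orb_r orb_refl.
Qed.

Lemma porbit_involution s x : involutive s -> porbit s x = [set x; s x].
Proof.
move=> sK; apply/setP=> y; rewrite !inE; apply/idP/orP=> [|[]/eqP->];
  last 2 first.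
- exact: porbit_id.
- by rewrite mem_porbit1 porbit_id.
move=> yx; apply/orP; move: yx.
apply: (@porbit_ind _ (fun w => (w == x) || (w == s x))); rewrite ?eqxx // => z.
by case/orP=> /eqP->; rewrite ?sK eqxx ?orbT.
Qed.

(** [b] acts trivially on an orbit that avoids [K]. *)
Lemma orb_disjoint a b K x : perm_on K b -> [disjoint orb a b x & K] ->
  orb a b x = porbit a x.
Proof.
move=> bK dis; apply/eqP; rewrite eqEsubset porbit_sub_orb andbT.
apply/subsetP=> y yx; suff /andP[] : (y \in porbit a x) && (y \in orb a b x)
  by [].
apply: (@orb_ind a b (fun w => (w \in porbit a x) && (w \in orb a b x))) yx
  => [z|z|]; last by rewrite porbit_id orb_refl.
  by rewrite mem_porbit1 orb_l.
by move=> /andP[zp zo]; rewrite (out_perm bK) ?zp ?zo ?(disjointFr dis).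
Qed.

Lemma porbit_disjoint a b K x : perm_on K b -> [disjoint porbit a x & K] ->
  porbit a x = orb a b x.
Proof.
move=> bK dis; apply/eqP; rewrite eqEsubset porbit_sub_orb /=.
apply/subsetP=> y; apply: (@orb_ind a b (fun w => w \in porbit a x));
  rewrite ?porbit_id // => z; first by rewrite mem_porbit1.
by move=> zp; rewrite (out_perm bK) // (disjointFr dis).
Qed.

End Orbits.

(** Orbits on different sets are compared by the relation of lying on a common
    orbit, which determines how many there are. *)
Lemma card_imset_transport (T U : finType) (V W : finType)
    (F : T -> V) (G : U -> W) (f : T -> U) (H : {set T}) (H' : {set U}) :
  {in H &, forall x y, (F x == F y) = (G (f x) == G (f y))} ->
  {in H, forall x, f x \in H'} ->
  {in H', forall y, exists2 x, x \in H & G (f x) = G y} ->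
  #|F @: H| = #|G @: H'|.
Proof.
move=> FG fH surj; have -> : G @: H' = (G \o f) @: H.
  apply/setP=> w; apply/imsetP/imsetP=> [[y /surj[x xH <-] ->]|[x xH ->]].
    by exists x.
  by exists (f x); first exact: fH.
(* The value of G at the points where F takes the value v. *)
pose g v := if [pick x in H | F x == v] is Some x then Some (G (f x)) else None.
have gF x : x \in H -> g (F x) = Some (G (f x)).
  rewrite /g => xH; case: pickP => [y /andP[yH]|/(_ x)]; last
    by rewrite xH eqxx.
  by rewrite FG // => /eqP->.
have gE : g @: (F @: H) = some @: ((G \o f) @: H).
  by rewrite -!imset_comp; apply: eq_in_imset => x xH; rewrite /= gF.
rewrite -[RHS](card_imset _ (@Some_inj _)) -gE;
  apply/esym/card_in_imset=> _ _ /imsetP[x xH ->] /imsetP[y yH ->].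
by rewrite !gF // => -[] /eqP; rewrite -FG // => /eqP.
Qed.

Section OrbitCount.

Variable T : finType.
Implicit Types (a b s : {perm T}) (x y : T) (H K : {set T}).

Lemma orb_stable a b H x y : perm_on H a -> perm_on H b -> x \in H ->
  y \in orb a b x -> y \in H.
Proof.
move=> Ha Hb xH; apply: (@orb_ind _ _ _ (fun w => w \in H)) => // z zH.
  by rewrite /= perm_closed.
by rewrite /= perm_closed.
Qed.

Lemma orb_transport (U : finType) (f : T -> U) a b (a' b' : {perm U}) H :
  {in H, forall x, a x \in H} -> {in H, forall x, b x \in H} ->
  {in H &, injective f} ->
  {in H, forall x, f (a x) = a' (f x)} -> {in H, forall x, f (b x)
    = b' (f x)} ->
  #|orb a b @: H| = #|orb a' b' @: (f @: H)|.
Proof.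
move=> Ha Hb finj fa fb; apply: (@card_imset_transport _ _ _ _ _ _ f) =>
  [x y xH yH|x xH|_ /imsetP[x xH ->]].
- rewrite !orbE; apply/idP/idP=> xy.
    have : (x \in H) && (f x \in orb a' b' (f y)).
      apply: (@orb_ind _ a b (fun w => (w \in H) && (f w \in orb a' b' (f y))))
        xy
      => [z|z|]; last by rewrite yH orb_refl.
        by move=> /andP[zH zy]; rewrite Ha // fa // orb_l.
      by move=> /andP[zH zy]; rewrite Hb // fb // orb_r.
    by case/andP.
  have : f x \in f @: (H :&: orb a b y).
    apply: (@orb_ind _ a' b' (fun w => w \in f @: (H :&: orb a b y))) xy.
    - move=> _ /imsetP[z /setIP[zH zy] ->]; rewrite /= -fa //.
      by apply: imset_f; rewrite inE Ha // orb_l.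
    - move=> _ /imsetP[z /setIP[zH zy] ->]; rewrite /= -fb //.
      by apply: imset_f; rewrite inE Hb // orb_r.
    by apply: imset_f; rewrite inE yH orb_refl.
  by case/imsetP=> z /setIP[zH zy] /finj ->.
- exact: imset_f.
by exists x.
Qed.

Lemma card_orb_meet (V : finType) (F : T -> {set V}) H (A : {set V}) :
  (#|F @: H| = #|[set O in F @: H | ~~ [disjoint O & A]]|
               + #|[set O in F @: H | [disjoint O & A]]|)%N.
Proof.
rewrite -(cardsID [set O : {set V} | ~~ [disjoint O & A]]); congr (_ + _)%N.
  by apply: eq_card => O; rewrite !inE.
by apply: eq_card => O; rewrite !inE negbK andbC.
Qed.

Lemma orbits_meet a b H K : perm_on H a -> perm_on H b -> K \subset H ->
  [set O in orb a b @: H | ~~ [disjoint O & K]] = orb a b @: K.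
Proof.
move=> Ha Hb /subsetP KH; apply/setP=> O; rewrite inE; apply/andP/imsetP.
  case=> /imsetP[x xH ->] /pred0Pn[y /andP[/= /orb_eqP yx yK]].
  by exists y.
case=> x xK ->; split; first by rewrite imset_f ?KH.
by apply/pred0Pn; exists x; rewrite /= orb_refl.
Qed.

Lemma induced_mem_porbit K s x : induced_fun K s x \in porbit s x.
Proof.
have [xK|/(@induced_fun_out _ _ s)->] := boolP (x \in K); last exact: porbit_id.
have [m _ [-> _]] := induced_fun_first s xK.
by elim: m => [|m IHm]; rewrite ?porbit_id //= mem_porbit1.
Qed.

Lemma porbit_iter s x m : iter m s x \in porbit s x.
Proof. by elim: m => [|m IHm]; rewrite ?porbit_id //= mem_porbit1. Qed.

Lemma porbit_fconnect s x y : (y \in porbit s x) = fconnect s x y.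
Proof.
apply/idP/idP=> [|/iter_findex<-]; last exact: porbit_iter.
apply: (@porbit_ind _ _ (fconnect s x)) => [z xz|]; last exact: connect0.
exact: connect_trans xz (fconnect1 _ _).
Qed.

Lemma porbit_induced K s x y : x \in K -> y \in K ->
  y \in porbit s x -> y \in porbit (induced K s) x.
Proof.
move=> xK yK; rewrite !porbit_fconnect => yx.
have [xf uf _] := induced_cycle s xK; set p := [seq _ <- _ | _] in xf uf.
have cf : fcycle (induced K s) p.
  rewrite (@eq_in_cycle _ (mem p) _ (frel (next p))); first exact: cycle_next.
    by move=> u v up _ /=; rewrite permE (induced_fun_orbit xK up).
  exact/allP.
rewrite (fconnect_cycle cf xf) mem_filter yK.
by rewrite -fconnect_orbit.
Qed.

(** A path of [a]- and [b]-steps between points of [K] leaves [K] and comes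
    back within one cycle of [a], and the points of [K] on a cycle of [a] form
    a cycle of the permutation induced by [a] on [K]. *)
Lemma orb_induced a b K x y : perm_on K b -> x \in K -> y \in K ->
  (y \in orb a b x) = (y \in orb (induced K a) b x).
Proof.
move=> bK xK yK; set i := induced K a; apply/idP/idP; last first.
  apply/subsetP/orb_sub => z; last by rewrite orb_r orb_refl.
  by rewrite permE; apply: (subsetP (porbit_sub_orb _ _ _));
    exact: induced_mem_porbit.
(* The orbit is covered by the cycles of a through its points in K. *)
pose P w := [exists z in K, (z \in orb i b x) && (w \in porbit a z)].
have PK w : w \in K -> P w -> w \in orb i b x.
  move=> wK /exists_inP[z zK /andP[zx wz]]; apply: orb_trans zx.
  by apply: (subsetP (porbit_sub_orb _ _ _)); exact: porbit_induced.
move=> yx; apply: (PK) => //; apply: (@orb_ind _ a b P) yx => [w|w Pw|].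
- case/exists_inP=> z zK /andP[zx wz].
  by apply/exists_inP; exists z; rewrite // zx mem_porbit1.
- have [wK|wK] := boolP (w \in K); last by rewrite (out_perm bK wK).
  apply/exists_inP; exists (b w); first by rewrite perm_closed.
  by rewrite orb_r PK //= porbit_id.
by apply/exists_inP; exists x; rewrite // orb_refl porbit_id.
Qed.

Lemma card_orb_induced a b H K : perm_on H a -> perm_on K b -> K \subset H ->
  #|orb a b @: H| = (#|orb (induced K a) b @: K|
    + #|[set v in porbit a @: H | [disjoint v & K]]|)%N.
Proof.
move=> Ha Kb KH; have Hb : perm_on H b := subset_trans Kb KH.
rewrite (card_orb_meet _ _ K) orbits_meet //; congr (_ + _)%N.
  apply: (@card_imset_transport _ _ _ _ _ _ id) => // [x y xK yK|x xK].
    by rewrite !orbE (@orb_induced a b K).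
  by exists x.
apply: eq_card => v; rewrite !inE; apply/andP/andP=> -[/imsetP[x xH ->] dis];
  split => //.
  by rewrite (orb_disjoint Kb dis) imset_f.
by rewrite (porbit_disjoint Kb dis) imset_f.
Qed.

(** [b * tperm x y] links [x] and [y] and moves the other points as [b] does, so
    that only the orbits of [x] and [y] are affected. *)
Lemma card_orb_tperm a b H x y : x \in H -> y \in H -> b x = x -> b y = y ->
  #|orb a b @: H| = (#|orb a (b * tperm x y)%g @: H| + (y \notin orb a b x))%N.
Proof.
move=> xH yH bx byE; set b' := (b * _)%g.
have b'x : b' x = y by rewrite permM bx tpermL.
have b'y : b' y = x by rewrite permM byE tpermR.
have b'z z : z != x -> z != y -> b' z = b z.
  move=> zx zy; rewrite permM tpermD //; apply/eqP=> bz.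
    by rewrite -[x]bx in bz; move/perm_inj: bz zx => ->; rewrite eqxx.
  by rewrite -[y]byE in bz; move/perm_inj: bz zy => ->; rewrite eqxx.
have sub z : orb a b z \subset orb a b' z.
  apply: orb_sub => w; first by rewrite orb_l orb_refl.
  have [->|wx] := eqVneq w x; first by rewrite bx orb_refl.
  have [->|wy] := eqVneq w y; first by rewrite byE orb_refl.
  by rewrite -b'z // orb_r orb_refl.
have yx' : y \in orb a b' x by rewrite -b'x orb_r orb_refl.
have off z : z \notin orb a b x -> z \notin orb a b y -> orb a b' z = orb a b z.
  move=> zx zy; apply/eqP; rewrite eqEsubset sub andbT; apply/subsetP=> w.
  apply: (@orb_ind _ _ _ (fun w => w \in orb a b z)) => [u uz|u uz|];
    rewrite /= ?orb_l ?orb_refl //.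
  have ux : u != x by apply: contraNneq zx => <-; rewrite orb_sym.
  have uy : u != y by apply: contraNneq zy => <-; rewrite orb_sym.
  by rewrite b'z ?orb_r.
have [yx|yx] := boolP (y \in orb a b x).
  rewrite addn0 (_ : orb a b' @: H = orb a b @: H) //; apply: eq_imset => z.
  apply/esym; apply: eq_orb => w; rewrite ?orb_l ?orb_refl //.
    by apply: (subsetP (sub w)); rewrite orb_r orb_refl.
  have [->|wx] := eqVneq w x; first by rewrite b'x.
  have [->|wy] := eqVneq w y; first by rewrite b'y orb_sym.
  by rewrite b'z // orb_r orb_refl.
pose A := [set z in H | (z \notin orb a b x) && (z \notin orb a b y)].
have -> : orb a b @: H = orb a b x |: (orb a b y |: orb a b @: A).
  apply/setP=> O; rewrite !inE; apply/imsetP/or3P=> [[z zH ->]|].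
    have [/orb_eqP->|zx] := boolP (z \in orb a b x); first by apply: Or31.
    have [/orb_eqP->|zy] := boolP (z \in orb a b y); first by apply: Or32.
    by apply: Or33; rewrite imset_f // inE zH zx.
  case=> [/eqP->|/eqP->|/imsetP[z]]; [by exists x|by exists y|].
  by rewrite inE => /andP[zH _] ->; exists z.
have -> : orb a b' @: H = orb a b' x |: orb a b @: A.
  apply/setP=> O; rewrite !inE; apply/imsetP/orP=> [[z zH ->]|].
    have [zx|zx] := boolP (z \in orb a b x).
      by left; apply/eqP/orb_eqP; apply: (subsetP (sub _)).
    have [zy|zy] := boolP (z \in orb a b y).
      left; apply/eqP/orb_eqP; apply: orb_trans yx'.
      exact: (subsetP (sub _)).
    by right; rewrite off // imset_f // inE zH zx.
  case=> [/eqP->|/imsetP[z]]; first by exists x.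
  by rewrite inE => /and3P[zH zx zy] ->; exists z; rewrite ?off.
have nA (c : {perm T}) z : z \in orb a b x :|: orb a b y ->
    (orb a c z \in orb a b @: A) = false.
  move=> zxy; apply/negP=> /imsetP[w]; rewrite inE => /and3P[_ wx wy] zw.
  have : z \in orb a b w by rewrite -zw orb_refl.
  move/orb_eqP => zwE; case/setUP: zxy => /orb_eqP zE.
    by case/negP: wx; rewrite -zE zwE orb_refl.
  by case/negP: wy; rewrite -zE zwE orb_refl.
rewrite !cardsU1 !inE.
have -> : orb a b x == orb a b y = false.
  by apply: contraNF yx => /eqP->; rewrite orb_refl.
by rewrite !nA ?inE ?orb_refl ?orbT //= addnC.
Qed.

Lemma card_porbit_on s H : perm_on H s ->
  #|porbits s| = (#|porbit s @: H| + #|~: H|)%N.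
Proof.
move=> sH; have -> : porbits s = porbit s @: H :|: porbit s @: (~: H).
  by rewrite -imsetU setUCr; apply/setP=> O; apply/imsetP/imsetP=> -[x _ ->];
    exists x.
have fixC x : x \in ~: H -> porbit s x = [set x].
  rewrite inE => xH; have sx := out_perm sH xH; apply/setP=> y; rewrite inE.
  apply/idP/eqP=> [|->]; last exact: porbit_id.
  by move=> yx; apply/eqP; apply: (@porbit_ind _ s (pred1 x)) yx =>
    /= [z /eqP->|//]; rewrite ?sx.
rewrite cardsU (_ : _ :&: _ = set0) ?cards0 ?subn0; last first.
  apply/setP=> O; rewrite !inE; apply/negP=> /andP[/imsetP[x xH ->] /imsetP[y
    yH]].
  rewrite (fixC y yH) => E; move: yH; rewrite inE.
  by have := porbit_id s x; rewrite E inE => /eqP<-; rewrite xH.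
congr (_ + _)%N; rewrite card_in_imset // => x y xH yH.
by rewrite !fixC // => /set1_inj.
Qed.

(** A transposition merges the cycles of two points or splits their common
    cycle.  The points outside [H] are fixed, and contribute the same number of
    cycles on both sides of [porbits_mul_tperm]. *)
Lemma card_porbit_tperm s H x y : perm_on H s -> x \in H -> y \in H -> x != y ->
  (#|porbit (tperm x y * s)%g @: H| + (y \notin porbit s x).*2
   = #|porbit s @: H|.+1)%N.
Proof.
move=> sH xH yH xy; have := porbits_mul_tperm s x y; rewrite /= xy.
rewrite (card_porbit_on sH) (@card_porbit_on _ H) ?(porbit_sym s x y) => [E|].
  by apply/eqP; rewrite -(eqn_add2r #|~: H|);
    rewrite addSn -[(_ + _).+1]addn1 -E addnAC.
apply: perm_onM => //; apply: subset_trans (tperm_on _ _) _.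
by apply/subsetP=> z /set2P[]->.
Qed.

Lemma porbit_tperm_merge s x y : x != y -> y \notin porbit s x ->
  y \in porbit (tperm x y * s)%g x.
Proof.
move=> xy yx; have := porbits_mul_tperm s x y;
  rewrite /= xy (porbit_sym s x y) yx.
have := porbits_mul_tperm (tperm x y * s)%g x y.
rewrite /= mulgA tperm2 mul1g xy porbit_sym.
move: #|porbits _| #|porbits _| => m n.
by case: (y \in _) => //= /eqP + /eqP; rewrite ?addn1 ?addn2 !eqSS; lia.
Qed.

Lemma porbit_conj_card s t H : perm_on H s -> perm_on H t ->
  #|porbit (s * t)%g @: H| = #|porbit (t * s)%g @: H|.
Proof.
move=> sH tH; rewrite !(eq_imset _ (porbit_orb _)).
rewrite (@orb_transport _ s _ _ (t * s)%g (t * s)%g); last first.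
- by move=> x _; rewrite !permM.
- by move=> x _; rewrite !permM.
- by move=> x y _ _; apply: perm_inj.
- by move=> x xH; rewrite permM !perm_closed.
- by move=> x xH; rewrite permM !perm_closed.
suff -> : s @: H = H by []; apply/setP=> y; apply/imsetP/idP=> [[x xH ->]|yH].
  by rewrite perm_closed.
by exists ((s^-1)%g y); rewrite ?permKV // perm_closed // perm_onV.
Qed.

End OrbitCount.

(** * Deletion and contraction in ribbon graphs *)

Section InducedProduct.

Variable T : finType.
Implicit Types (a b s : {perm T}) (x y : T) (H K : {set T}).

Lemma tperm_commute b x y : b x = x -> b y = y -> (b * tperm x y
  = tperm x y * b)%g.
Proof.
move=> bx byE; apply/permP=> z; rewrite !permM.
by rewrite -[in LHS]bx -[in LHS]byE -inj_tperm //; apply: perm_inj.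
Qed.

Lemma porbit_orb1 s x : porbit s x = orb s 1%g x.
Proof.
rewrite porbit_orb; apply: eq_orb => z; rewrite ?orb_l ?orb_refl //.
by rewrite perm1 orb_refl.
Qed.

Lemma induced_fun_unique K s x m : x \in K -> (0 < m)%N -> iter m s x \in K ->
  (forall j, (0 < j < m)%N -> iter j s x \notin K) ->
  induced_fun K s x = iter m s x.
Proof.
move=> xK m0 mK out; have [n n0 [E out']] := induced_fun_first s xK.
have nK := induced_fun_in s xK; rewrite E in nK *.
have [mn|nm|->//] := ltngtP m n.
  by have := out' m; rewrite m0 mn mK => /(_ isT).
by have := out n; rewrite n0 nm nK => /(_ isT).
Qed.

(** Outside [K] the permutation [b] does nothing, so the first return to [K]
    of [b * s] from [x] is the first return of [s] from [b x]. *)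
Lemma induced_mul K b s : perm_on K b -> induced K (b * s)%g
  = (b * induced K s)%g.
Proof.
move=> bK; apply/permP=> x; rewrite permM !permE.
have [xK|xK] := boolP (x \in K); last
  by rewrite (out_perm bK xK) !induced_fun_out.
have bxK : b x \in K by rewrite perm_closed.
have [m m0 [E out]] := induced_fun_first s bxK.
have step j : (0 < j <= m)%N -> iter j (b * s)%g x = iter j s (b x).
  elim: j => // j IHj jm; case: j IHj jm => [|j] IHj jm; first
    by rewrite /= permM.
  rewrite iterS IHj ?(ltnW (andP jm).2) // permM [in RHS]iterS (out_perm bK) //.
  exact: out.
rewrite E -step ?m0 ?leqnn //; apply: induced_fun_unique => //.
  by rewrite step ?m0 ?leqnn // -E induced_fun_in.
by move=> j /andP[j0 jm]; rewrite step ?j0 ?(ltnW jm) // out ?j0.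
Qed.

Lemma porbit_mul_disjoint K b s x : perm_on K b -> [disjoint porbit s x & K] ->
  porbit (b * s)%g x = porbit s x.
Proof.
move=> bK dis; have E y : y \in porbit s x -> (b * s)%g y = s y.
  by move=> yx; rewrite permM (out_perm bK) // (disjointFr dis).
have sub y : y \in porbit (b * s)%g x -> y \in porbit s x.
  by apply: (@porbit_ind _ _ (fun w => w \in porbit s x));
    rewrite ?porbit_id // => w wx; rewrite E // mem_porbit1.
apply/setP=> y; apply/idP/idP; first exact: sub.
apply: (@porbit_ind _ _ (fun w => w \in porbit (b * s)%g x));
  rewrite ?porbit_id // => w wx.
by rewrite -E ?mem_porbit1 // sub.
Qed.

Lemma card_porbit_mul_induced b s H K : perm_on H s -> perm_on K b ->
  K \subset H ->
  #|porbit (b * s)%g @: H| = (#|porbit (b * induced K s)%g @: K|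
    + #|[set v in porbit s @: H | [disjoint v & K]]|)%N.
Proof.
move=> Hs Kb KH; rewrite !(eq_imset _ (porbit_orb1 _)).
have Hb : perm_on H b := subset_trans Kb KH.
have bsH : perm_on H (b * s)%g by rewrite perm_onM.
rewrite (@card_orb_induced _ _ _ H K) ?perm_on1 //.
rewrite induced_mul //; congr (_ + _)%N; apply: eq_card => v; rewrite !inE.
apply/andP/andP=> -[/imsetP[x xH ->]] dis; split=> //; apply/imsetP;
  exists x => //.
  rewrite -porbit_orb1 -(porbit_mul_disjoint (perm_onV Kb) dis) mulKg //.
by rewrite porbit_orb1 in dis *;
  rewrite -!porbit_orb1 (porbit_mul_disjoint Kb) // porbit_orb1.
Qed.

End InducedProduct.

Section Deletion.

Variable T : finType.
Implicit Types (D : ribbon T) (h x y : T) (E : {set {set T}}).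

Lemma sigma0_on D : perm_on (half_edges D) (sigma0 D).
Proof. by case/and4P: (ribbonP D). Qed.

Lemma sigma1_on D : perm_on (half_edges D) (sigma1 D).
Proof. by case/and4P: (ribbonP D). Qed.

Lemma sigma1K D : involutive (sigma1 D).
Proof. by case/and4P: (ribbonP D) => _ _ /forallP s1K _ x; apply/eqP. Qed.

Lemma sigma1_neq D h : h \in half_edges D -> sigma1 D h != h.
Proof. by case/and4P: (ribbonP D) => _ _ _ /forall_inP; apply. Qed.

Lemma sigma1_half_edge D h : (sigma1 D h \in half_edges D)
  = (h \in half_edges D).
Proof. by rewrite (perm_closed _ (sigma1_on D)). Qed.

Lemma mem_edge_of D h x : (x \in edge_of D h) = (x == h) || (x == sigma1 D h).
Proof.
by rewrite /edge_of porbit_involution ?inE //; apply: sigma1K.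
Qed.

Lemma edge_of_sigma1 D h : edge_of D (sigma1 D h) = edge_of D h.
Proof. by apply/eqP; rewrite eq_porbit_mem mem_porbit1 porbit_id. Qed.

Lemma edge_of_eq D h x : (edge_of D x == edge_of D h)
  = (x == h) || (x == sigma1 D h).
Proof. by rewrite eq_porbit_mem -/(edge_of D h) mem_edge_of. Qed.

Lemma kept_sub D E : kept D E \subset half_edges D.
Proof. by apply/subsetP=> x; rewrite inE => /andP[]. Qed.

Lemma sigma1_kept D E x : (sigma1 D x \in kept D E) = (x \in kept D E).
Proof. by rewrite !inE sigma1_half_edge edge_of_sigma1. Qed.

Lemma sigma1_delete D E x :
  sigma1 (delete D E) x = if x \in kept D E then sigma1 D x else x.
Proof.
rewrite /=; case: ifPn => xK; last exact: (out_perm (restr_perm_on _ _)).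
rewrite restr_permE // in_setI inE /= inE; apply/subsetP=> y yK.
by rewrite inE apermE sigma1_kept.
Qed.

Lemma edge_of_delete D E x : x \in kept D E -> edge_of (delete D E) x
  = edge_of D x.
Proof.
by move=> xK; apply/setP=> y; rewrite !mem_edge_of sigma1_delete xK.
Qed.

Lemma kept_delete D E1 E2 : kept (delete D E1) E2 = kept D (E1 :|: E2).
Proof.
apply/setP=> x; rewrite [LHS]inE /=.
have [xK|xK] := boolP (x \in kept D E1).
  by rewrite edge_of_delete //; move: xK; rewrite !inE => /andP[-> /negPf->].
by move: xK; rewrite !inE !negb_and !negb_or => /orP[/negPf->|/negbNE->] //;
  rewrite andbF.
Qed.

Lemma sigma1_delete_delete D E1 E2 :
  sigma1 (delete (delete D E1) E2) = sigma1 (delete D (E1 :|: E2)).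
Proof.
apply/permP=> x; rewrite !sigma1_delete kept_delete.
case: ifP => // xK; suff -> : x \in kept D E1 by [].
by move: xK; rewrite !inE negb_or => /and3P[-> ->].
Qed.

Lemma edges_delete D E : edges (delete D E) = edges D :\: E.
Proof.
apply/setP=> e; rewrite inE; apply/imsetP/andP=> [[x xK ->]|[eE /imsetP[x xD
  ex]]].
  by rewrite edge_of_delete //; move: xK; rewrite inE => /andP[xD ->];
    rewrite imset_f.
have xK : x \in kept D E by rewrite inE xD -ex.
by exists x; rewrite ?edge_of_delete.
Qed.

Lemma num_edges_delete D E : E \subset edges D ->
  num_edges (delete D E) = (num_edges D - #|E|)%N.
Proof. by move=> ED; rewrite /num_edges edges_delete cardsD (setIidPr ED). Qed.

Lemma delete_orbits D E (b : {perm T}) : perm_on (kept D E) b ->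
  (#|orb (sigma0 (delete D E)) b @: half_edges (delete D E)|
     + isolated (delete D E)
   = #|orb (sigma0 D) b @: half_edges D| + isolated D)%N.
Proof.
move=> Kb; rewrite (card_orb_induced (sigma0_on D) Kb (kept_sub D E)) /=.
by rewrite -[RHS]addnA; congr (_ + _)%N; exact: addnC.
Qed.

Lemma delete_porbits D E (b : {perm T}) : perm_on (kept D E) b ->
  (#|porbit (b * sigma0 (delete D E))%g @: half_edges (delete D E)|
     + isolated (delete D E)
   = #|porbit (b * sigma0 D)%g @: half_edges D| + isolated D)%N.
Proof.
move=> Kb; rewrite (card_porbit_mul_induced (sigma0_on D) Kb (kept_sub D E)) /=.
by rewrite -[RHS]addnA; congr (_ + _)%N; exact: addnC.
Qed.

Lemma num_components_delete D E : num_components (delete D E) =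
  (#|orb (sigma0 D) (sigma1 (delete D E)) @: half_edges D| + isolated D)%N.
Proof. by rewrite -(delete_orbits (sigma1_on (delete D E))). Qed.

Lemma num_facesE D : num_faces D =
  (#|porbit (sigma1 D * sigma0 D)%g @: half_edges D| + isolated D)%N.
Proof. by rewrite /num_faces (eq_imset _ (porbitV _)). Qed.

Lemma num_faces_delete D E : num_faces (delete D E) =
  (#|porbit (sigma1 (delete D E) * sigma0 D)%g @: half_edges D| + isolated D)%N.
Proof. by rewrite num_facesE (delete_porbits (sigma1_on (delete D E))). Qed.

Lemma num_vertices_delete D E : num_vertices (delete D E) = num_vertices D.
Proof.
have := @delete_porbits D E 1%g (perm_on1 _); rewrite !mul1g => E1.
exact: E1.
Qed.

Lemma num_components_delete_delete D E1 E2 :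
  num_components (delete (delete D E1) E2)
    = num_components (delete D (E1 :|: E2)).
Proof.
rewrite num_components_delete delete_orbits ?sigma1_delete_delete.
  by rewrite -num_components_delete.
apply: subset_trans (sigma1_on _) _ => /=; apply/subsetP=> x.
by rewrite !inE negb_or => /and3P[-> ->].
Qed.

Lemma num_faces_delete_delete D E1 E2 :
  num_faces (delete (delete D E1) E2) = num_faces (delete D (E1 :|: E2)).
Proof.
rewrite num_faces_delete delete_porbits ?sigma1_delete_delete.
  by rewrite -num_faces_delete.
apply: subset_trans (sigma1_on _) _ => /=; apply/subsetP=> x.
by rewrite !inE negb_or => /and3P[-> ->].
Qed.

Lemma sigma1_delete_edge D E h : h \in half_edges D -> edge_of D h \notin E ->
  sigma1 (delete D E)
  = (sigma1 (delete D (edge_of D h |: E)) * tperm h (sigma1 D h))%g.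
Proof.
move=> hD hE; apply/permP=> x; rewrite permM !sigma1_delete.
have xE : (x \in kept D (edge_of D h |: E)) =
    (x \in kept D E) && ~~ ((x == h) || (x == sigma1 D h)).
  by rewrite !inE edge_of_eq negb_or -andbA [~~ _ && ~~ _]andbC.
rewrite xE; have [->|xh] := eqVneq x h.
  by rewrite andbF tpermL inE hD hE.
have [->|xh'] := eqVneq x (sigma1 D h).
  by rewrite andbF tpermR sigma1_kept inE hD hE sigma1K.
rewrite andbT; case: ifP => xK; last by rewrite tpermD // eq_sym.
by rewrite tpermD // eq_sym ?(inj_eq perm_inj) // (can2_eq (sigma1K D) (sigma1K
  D)).
Qed.

Lemma sigma1_delete_fix D E h : edge_of D h \in E ->
  sigma1 (delete D E) h = h /\ sigma1 (delete D E) (sigma1 D h) = sigma1 D h.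
Proof. by move=> hE; rewrite !sigma1_delete !inE edge_of_sigma1 hE !andbF. Qed.

Lemma num_components_add_edge D E h : h \in half_edges D ->
  edge_of D h \notin E ->
  num_components (delete D (edge_of D h |: E))
  = (num_components (delete D E) + (sigma1 D h
      \notin orb (sigma0 D) (sigma1 (delete D (edge_of D h |: E))) h))%N.
Proof.
move=> hD hE; rewrite !num_components_delete (sigma1_delete_edge hD hE).
have [f1 f2] := @sigma1_delete_fix D (edge_of D h |: E) h (setU11 _ _).
have hD' : sigma1 D h \in half_edges D by rewrite sigma1_half_edge.
by rewrite (card_orb_tperm (sigma0 D) hD hD' f1 f2) addnAC.
Qed.

Lemma num_faces_add_edge D E h : h \in half_edges D -> edge_of D h \notin E ->
  (num_faces (delete D E) + (sigma1 D h
      \notin porbit (sigma1 (delete D (edge_of D h |: E)) * sigma0 D)%g h).*2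
   = (num_faces (delete D (edge_of D h |: E))).+1)%N.
Proof.
move=> hD hE; rewrite !num_faces_delete (sigma1_delete_edge hD hE).
set b := sigma1 _; set t := tperm _ _.
have [f1 f2] := @sigma1_delete_fix D (edge_of D h |: E) h (setU11 _ _).
have hD' : sigma1 D h \in half_edges D by rewrite sigma1_half_edge.
have bH : perm_on (half_edges D) b.
  exact: subset_trans (sigma1_on (delete D _)) (kept_sub _ _).
rewrite (tperm_commute f1 f2) -mulgA addnAC card_porbit_tperm //.
  by rewrite perm_onM ?sigma0_on.
by rewrite eq_sym sigma1_neq.
Qed.

End Deletion.

Section Contraction.

Variable T : finType.
Implicit Types (D : ribbon T) (h x y : T) (E : {set {set T}}).

Lemma sigma0_join_merge D h : h \in half_edges D -> ~~ is_loop D h ->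
  sigma1 D h \in porbit (sigma0 (join D h)) h.
Proof.
move=> hD hl; rewrite -porbitV /= invMg tpermV porbit_tperm_merge ?porbitV //.
by rewrite eq_sym sigma1_neq.
Qed.

(** The half-edges of [h] lie on one vertex of [join D h], so that it makes no
    difference to the components whether the vertices of [h] are joined or the
    edge [h] is present. *)
Lemma join_orbits D h (b : {perm T}) : h \in half_edges D -> ~~ is_loop D h ->
    b h = h -> b (sigma1 D h) = sigma1 D h ->
  orb (sigma0 (join D h)) b =1 orb (sigma0 D) (b * tperm h (sigma1 D h))%g.
Proof.
move=> hD hl bh bh' x; set t := tperm _ _; set h' := sigma1 D h in bh' t *.
have t_mem (c d : {perm T}) : h' \in orb c d h -> forall z, t z \in orb c d z.
  by move=> ch z; rewrite /t; case: tpermP => [->|->|_ _] //;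
    rewrite ?orb_refl // orb_sym.
have tj : h' \in orb (sigma0 (join D h)) b h.
  by apply: (subsetP (porbit_sub_orb _ _ _)); apply: sigma0_join_merge.
have td : h' \in orb (sigma0 D) (b * t)%g h.
  by rewrite -[X in X \in _](_ : (b * t)%g h
    = h') ?orb_r ?orb_refl // permM bh tpermL.
apply: eq_orb => z.
- by rewrite /= permM; apply: orb_trans (t_mem _ _ td _) _;
  rewrite orb_l orb_refl.
- rewrite -[b z](tpermK h h') -/t -[t (b z)]permM;
  apply: orb_trans (t_mem _ _ td _) _.
  by rewrite orb_r orb_refl.
- rewrite -[sigma0 D z](tpermK h h') -/t -[t (sigma0 D z)]permM;
  apply: orb_trans (t_mem _ _ tj _) _.
  by rewrite (orb_l (sigma0 (join D h))) orb_refl.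
- by rewrite permM; apply: orb_trans (t_mem _ _ tj _) _; rewrite orb_r orb_refl.
Qed.

(** Conjugation by the transposition carries it from one side of [sigma0] to the
    other. *)
Lemma join_faces D h (b : {perm T}) : h \in half_edges D ->
    perm_on (half_edges D) b -> b h = h -> b (sigma1 D h) = sigma1 D h ->
  #|porbit (b * sigma0 (join D h))%g @: half_edges D|
  = #|porbit (b * tperm h (sigma1 D h) * sigma0 D)%g @: half_edges D|.
Proof.
move=> hD bD bh bh'; rewrite /= mulgA (porbit_conj_card (H := half_edges D)).
- by rewrite (tperm_commute bh bh') mulgA.
- by rewrite perm_onM ?sigma0_on.
apply: subset_trans (tperm_on _ _) _.
by apply/subsetP=> z /set2P[]->; rewrite ?sigma1_half_edge.
Qed.

Lemma num_vertices_join D h : h \in half_edges D -> ~~ is_loop D h ->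
  (num_vertices (join D h)).+1 = num_vertices D.
Proof.
move=> hD hl; have hD' : sigma1 D h \in half_edges D
  by rewrite sigma1_half_edge.
have hh' : h != sigma1 D h by rewrite eq_sym sigma1_neq.
rewrite /num_vertices /= (porbit_conj_card (H := half_edges D)) ?sigma0_on //;
  last first.
  by apply: subset_trans (tperm_on _ _) _; apply/subsetP=> z /set2P[]->.
have := card_porbit_tperm (sigma0_on D) hD hD' hh'; rewrite hl /= addn2 =>
  -[<-].
by rewrite addSn.
Qed.

Lemma num_vertices_contract D h : h \in half_edges D -> ~~ is_loop D h ->
  (num_vertices (contract D h)).+1 = num_vertices D.
Proof. by move=> hD hl; rewrite num_vertices_delete num_vertices_join. Qed.

Lemma edges_contract D h : edges (contract D h) = edges D :\ edge_of D h.
Proof. by rewrite edges_delete. Qed.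

Lemma sigma1_delete_join D h E : sigma1 (delete (join D h) E)
  = sigma1 (delete D E).
Proof. by []. Qed.

Lemma num_components_delete_contract D h E : h \in half_edges D ->
  ~~ is_loop D h ->
  edge_of D h \notin E ->
  num_components (delete (contract D h) E) = num_components (delete D E).
Proof.
move=> hD hl hE; rewrite num_components_delete_delete !num_components_delete.
rewrite sigma1_delete_join (sigma1_delete_edge hD hE).
have [f1 f2] := @sigma1_delete_fix _ D (edge_of D h |: E) h (setU11 _ _).
by rewrite (eq_imset _ (join_orbits hD hl f1 f2)).
Qed.

Lemma num_faces_delete_contract D h E : h \in half_edges D ->
  edge_of D h \notin E ->
  num_faces (delete (contract D h) E) = num_faces (delete D E).
Proof.
move=> hD hE; rewrite num_faces_delete_delete !num_faces_delete.
rewrite sigma1_delete_join (sigma1_delete_edge hD hE).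
have [f1 f2] := @sigma1_delete_fix _ D (edge_of D h |: E) h (setU11 _ _).
rewrite -(join_faces hD _ f1 f2) //.
exact: subset_trans (sigma1_on (delete D _)) (kept_sub _ _).
Qed.

End Contraction.

Section Euler.

Variable T : finType.
Implicit Types (D : ribbon T) (h x y : T) (E : {set {set T}}).

Lemma sigma1_delete0 D : sigma1 (delete D set0) = sigma1 D.
Proof.
apply/permP=> x; rewrite sigma1_delete !inE andbT; case: ifPn => // xD.
by rewrite (out_perm (sigma1_on D) xD).
Qed.

Lemma num_components_delete0 D : num_components (delete D set0)
  = num_components D.
Proof. by rewrite num_components_delete sigma1_delete0. Qed.

Lemma sigma1_delete_all D : sigma1 (delete D (edges D)) = 1%g.
Proof.
apply/permP=> x; rewrite sigma1_delete perm1 inE; case: ifP => // /andP[xD].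
by rewrite imset_f.
Qed.

Lemma num_components_delete_all D : num_components (delete D (edges D))
  = num_vertices D.
Proof.
by rewrite num_components_delete sigma1_delete_all -(eq_imset _ (porbit_orb1
  _)).
Qed.

Lemma num_faces_delete_all D : num_faces (delete D (edges D)) = num_vertices D.
Proof. by rewrite num_faces_delete sigma1_delete_all mul1g. Qed.

(** Insert the edges one at a time into the graph without edges, for which
    [k = v = f].  An edge that joins two components also joins two faces; any
    other edge leaves [k] unchanged and changes [f] by one. *)
Lemma ribbon_euler D E : E \subset edges D ->
  (num_vertices D <= num_edges D - #|E| + num_components (delete D E))%N /\
  exists g, (num_vertices D + num_faces (delete D E) + g.*2
    = num_components (delete D E) *2 + (num_edges D - #|E|))%N.
Proof.
have [n] := ubnP #|edges D :\: E|; elim: n E => // n IHn E En ED.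
have [DE|] := boolP (edges D \subset E).
  have -> : E = edges D by apply/eqP; rewrite eqEsubset ED.
  rewrite num_components_delete_all num_faces_delete_all /num_edges subnn.
  by split=> //; exists 0%N; lia.
case/subsetPn=> _ /imsetP[h hD ->] hE; set e := edge_of D h in hE.
have eD : e \in edges D by apply: imset_f.
have EeD : e |: E \subset edges D by rewrite subUset sub1set eD.
have [|vk [g vf]] := IHn (e |: E) _ EeD.
  move: En; rewrite (cardsD1 e) !inE hE eD /= ltnS add1n; apply: leq_trans.
  by rewrite ltnS; apply: subset_leq_card; apply/subsetP=> x;
    rewrite !inE negb_or -andbA.
have cE : #|e |: E| = #|E|.+1 by rewrite cardsU1 hE.
have lE : (#|E| < num_edges D)%N by rewrite -cE subset_leq_card.
have kE := num_components_add_edge hD hE.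
have fE := num_faces_add_edge hD hE.
rewrite -/e cE in kE fE vk vf.
have kf : sigma1 D h \notin orb (sigma0 D) (sigma1 (delete D (e |: E))) h ->
    sigma1 D h \notin porbit (sigma1 (delete D (e |: E)) * sigma0 D)%g h.
  apply: contra; apply: (@porbit_ind _ _
    (fun w => w \in orb (sigma0 D) (sigma1 (delete D (e |: E))) h)) => [z zh|].
    by rewrite permM orb_l orb_r.
  exact: orb_refl.
move: kE fE kf vk vf; set k' := num_components _; set k := num_components _.
set f' := num_faces (delete _ (e |: E)); set f := num_faces _.
set v := num_vertices D; set m := num_edges D in lE *.
move: (sigma1 D h \in orb _ _ _) (sigma1 D h \in porbit _ _) => p q.
clearbody k k' f f' v m; move: #|E| lE => c lE; clear -lE.
case: p; case: q => /= kE fE kf vk vf; last 1 first.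
- by split; [lia|exists g; lia].
- by split; [lia|exists g; lia].
- by split; [lia|exists g.+1; lia].
- by have := kf isT.
Qed.

End Euler.

(** * The state sum for the Bollobas-Riordan-Tutte polynomial *)

Section SubsetSums.

Variable V : nmodType.

Lemma sum_subsets_setD1 (S : finType) (A : {set S}) (e : S) (F : {set S} -> V) :
  e \in A ->
  \sum_(E : {set S} | E \subset A) F E
  = \sum_(E : {set S} | E \subset A :\ e) F E
    + \sum_(E : {set S} | E \subset A :\ e) F (e |: E).
Proof.
move=> eA; rewrite (bigID (fun E : {set S} => e \in E)) /= addrC; congr (_ + _).
  by apply: eq_bigl => E; rewrite subsetD1.
rewrite (reindex_onto (fun E => e |: E) (fun E => E :\ e)) /=; last first.
  by move=> E /andP[_ eE]; rewrite setD1K.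
apply: eq_bigl => E; rewrite setU11 andbT subUset sub1set eA /= subsetD1.
congr (_ && _); apply/eqP/idP=> [<-|eE]; first by rewrite !inE eqxx.
by rewrite setU1K.
Qed.

Lemma sum_subsets_imset (S S' : finType) (g : S -> S') (A : {set S})
    (F : {set S'} -> V) : {in A &, injective g} ->
  \sum_(E : {set S'} | E \subset g @: A) F E
  = \sum_(E : {set S} | E \subset A) F (g @: E).
Proof.
move=> ginj; transitivity (\sum_(E in [set g @: E | E : {set S} in powerset A])
  F E).
  apply: eq_bigl => E; apply/idP/imsetP=> [EA|[B]]; last first.
    by rewrite inE => BA ->; exact: imsetS.
  exists (A :&: g @^-1: E); first by rewrite inE subsetIl.
  apply/setP=> y; apply/idP/imsetP=> [yE|[x]].
    have /imsetP[x xA yx] := subsetP EA y yE.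
    by exists x; rewrite // !inE xA -yx.
  by rewrite !inE => /andP[_ gx] ->.
rewrite big_imset /=; first by apply: eq_bigl => E; rewrite inE.
move=> B C; rewrite !inE => BA CA BC; apply/setP=> x.
suff sub (B1 C1 : {set S}) : B1 \subset A -> C1 \subset A -> g @: B1
  = g @: C1 ->
    x \in B1 -> x \in C1 by apply/idP/idP; apply: sub.
move=> {}BA {}CA {}BC xB.
have : g x \in g @: C1 by rewrite -BC imset_f.
by case/imsetP=> y yC /ginj -> //; [apply: (subsetP BA) | apply: (subsetP CA)].
Qed.

Lemma sum_subsets_compl (S : finType) (A : {set S}) (F : {set S} -> V) :
  \sum_(B : {set S} | B \subset A) F B
    = \sum_(B : {set S} | B \subset A) F (A :\: B).
Proof.
have invol (B : {set S}) : B \subset A -> A :\: (A :\: B) = B.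
  by move=> BA; rewrite setDDr setDv set0U; apply/setIidPr.
rewrite (reindex_onto (fun B => A :\: B) (fun B => A :\: B)) => [|B BA];
  last exact: invol.
apply: eq_bigl => B; rewrite subsetDl /=; apply/eqP/idP=> [<-|];
  last exact: invol.
exact: subsetDl.
Qed.

End SubsetSums.

(** The exponent of [X - 1] is meant as [k(H) - k(D)] for a spanning subgraph
    [H] of a connected [D]. *)
Definition brt_weight (T : finType) (D : ribbon T) : {mpoly int[3]} :=
  ('X_X3 - 1) ^+ (num_components D).-1 * ('X_Y3 ^+ nullity D * 'X_Z3 ^+ genus
    D).

(** Every bridge missing from a spanning subgraph contributes a factor
    [X - 1], so that the subgraphs with and without a bridge add up to a factor
    [X]. *)
Definition brt_sum (T : finType) (D : ribbon T) : {mpoly int[3]} :=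
  \sum_(E : {set {set T}} | E \subset edges D) brt_weight (delete D E).

Lemma brt_weight_eq (T T' : finType) (D : ribbon T) (D' : ribbon T') :
  num_components D = num_components D' -> num_vertices D = num_vertices D' ->
  num_edges D = num_edges D' -> num_faces D = num_faces D' ->
  brt_weight D = brt_weight D'.
Proof. by rewrite /brt_weight /nullity /genus => -> -> -> ->. Qed.

Section BRTSum.

Variable T : finType.
Implicit Types (D : ribbon T) (h x y : T) (E : {set {set T}}).

Lemma num_edges_delete1 D E h : h \in half_edges D -> edge_of D h \notin E ->
  num_edges (delete D E) = (num_edges (delete D (edge_of D h |: E))).+1.
Proof.
move=> hD hE; rewrite /num_edges !edges_delete (cardsD1 (edge_of D h)).
rewrite inE hE imset_f //= add1n; congr _.+1; apply: eq_card => x.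
by rewrite !inE negb_or andbA.
Qed.

Lemma brt_weight_contract D h E : h \in half_edges D -> ~~ is_loop D h ->
  edge_of D h \notin E ->
  brt_weight (delete (contract D h) E) = brt_weight (delete D E).
Proof.
move=> hD hl hE; rewrite /brt_weight /nullity /genus.
rewrite num_components_delete_contract // num_faces_delete_contract //.
rewrite !(num_vertices_delete _ E) -(num_vertices_contract hD hl).
rewrite (num_edges_delete1 hD hE).
have -> : num_edges (delete (contract D h) E)
  = num_edges (delete D (edge_of D h |: E)).
  by rewrite /num_edges (edges_delete (contract D h)) edges_contract
    edges_delete setDDl.
set k := num_components _; set v := num_vertices _; set f := num_faces _.
set m := num_edges _; congr (_ * (_ ^+ _ * _ ^+ _)); clearbody k v f m; lia.
Qed.

Lemma brt_sum_delete D h : h \in half_edges D ->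
  brt_sum (delete D [set edge_of D h])
  = \sum_(E : {set {set T}} | E \subset edges D :\ edge_of D h)
      brt_weight (delete D (edge_of D h |: E)).
Proof.
move=> hD; rewrite /brt_sum edges_delete; apply: eq_bigr => E _.
apply: brt_weight_eq.
- exact: num_components_delete_delete.
- by rewrite !num_vertices_delete.
- by rewrite /num_edges !edges_delete setDDl.
exact: num_faces_delete_delete.
Qed.

Lemma brt_sum_contract D h : h \in half_edges D -> ~~ is_loop D h ->
  brt_sum (contract D h)
  = \sum_(E : {set {set T}} | E \subset edges D :\ edge_of D h)
      brt_weight (delete D E).
Proof.
move=> hD hl; rewrite /brt_sum edges_contract; apply: eq_bigr => E.
by rewrite subsetD1 => /andP[_]; apply: brt_weight_contract.
Qed.

Lemma brt_sum_delete_contract D h : h \in half_edges D -> ~~ is_loop D h ->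
  brt_sum D = brt_sum (delete D [set edge_of D h]) + brt_sum (contract D h).
Proof.
move=> hD hl; rewrite brt_sum_delete // brt_sum_contract // addrC.
by rewrite -sum_subsets_setD1 // imset_f.
Qed.

Lemma num_components_gt0 D : (half_edges D != set0) || (0 < isolated D)%N ->
  (0 < num_components D)%N.
Proof.
case/orP=> [/set0Pn[x xD]|D0]; rewrite addn_gt0 ?D0 ?orbT //.
by apply/orP; left; rewrite card_gt0; apply/set0Pn; eexists; apply: imset_f xD.
Qed.

Lemma num_components_le D : (num_components D <= num_vertices D)%N.
Proof.
rewrite leq_add2r; set s := sigma0 D; set b := sigma1 D.
have -> : orb s b @: half_edges D
    = (fun O : {set T} => \bigcup_(x in O) orb s b x) @: (porbit s @:
      half_edges D).
  rewrite -imset_comp; apply: eq_imset => x /=; apply/setP=> y.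
  apply/idP/bigcupP=> [yx|[z zx]]; first by exists x; rewrite ?porbit_id.
  move=> yz; apply: orb_trans yz _.
  exact: (subsetP (porbit_sub_orb _ _ _)).
exact: leq_imset_card.
Qed.

Lemma orb_delete_sub D E1 E2 x : E1 \subset E2 ->
  orb (sigma0 D) (sigma1 (delete D E2)) x \subset
  orb (sigma0 D) (sigma1 (delete D E1)) x.
Proof.
move=> E12; apply: orb_sub => z; first by rewrite orb_l orb_refl.
rewrite sigma1_delete; case: ifPn => [zK|]; last by rewrite orb_refl.
suff zK1 : z \in kept D E1.
  by have := orb_r (sigma0 D) (sigma1 (delete D E1)) z z;
    rewrite sigma1_delete zK1 orb_refl.
by move: zK; rewrite !inE => /andP[-> /=]; apply: contra; apply: (subsetP E12).
Qed.

Lemma bridge_disconnects D h : ribbon_connected D -> h \in half_edges D ->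
  is_bridge D h ->
  sigma1 D h \notin orb (sigma0 D) (sigma1 (delete D [set edge_of D h])) h.
Proof.
rewrite /ribbon_connected /is_bridge => /eqP c1 hD; rewrite c1.
have := @num_components_add_edge _ D set0 h hD; rewrite inE setU0 => -> //.
by rewrite num_components_delete0 c1; case: (_ \in _).
Qed.

Lemma is_bridge_nloop D h : ribbon_connected D -> h \in half_edges D ->
  is_bridge D h ->
  ~~ is_loop D h.
Proof.
move=> cD hD hb; apply: contra (bridge_disconnects cD hD hb).
exact/subsetP/porbit_sub_orb.
Qed.

(** A spanning subgraph without the bridge has one more component and one more
    face than with it, hence the same nullity and genus. *)
Lemma brt_sum_bridge D h : ribbon_connected D -> h \in half_edges D ->
  is_bridge D h ->
  brt_sum D = 'X_X3 * brt_sum (contract D h).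
Proof.
move=> cD hD hb; have hl := is_bridge_nloop cD hD hb.
rewrite (brt_sum_delete_contract hD hl) -[X in X * _](subrK 1) mulrDl mul1r;
  congr (_ + _).
rewrite brt_sum_delete // brt_sum_contract // mulr_sumr; apply: eq_bigr => E.
rewrite subsetD1 => /andP[_ hE].
have sep : sigma1 D h \notin
    orb (sigma0 D) (sigma1 (delete D (edge_of D h |: E))) h.
  apply: contra (bridge_disconnects cD hD hb).
  by apply/subsetP/orb_delete_sub; rewrite sub1set setU11.
have sepf := contra (subsetP (porbit_mul_sub_orb _ _ _) _) sep.
rewrite /brt_weight /nullity /genus (num_edges_delete1 hD hE)
  !num_vertices_delete.
have := num_components_add_edge hD hE; rewrite sep /= addn1 => ->.
have := num_faces_add_edge hD hE; rewrite sepf /= addn2 => -[<-].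
have : (0 < num_components (delete D E))%N.
  apply: num_components_gt0; rewrite /= -implyNb negbK; apply/implyP => /eqP K0.
  have : h \in kept D E by rewrite inE hD hE.
  by rewrite K0 inE.
set k := num_components _; set v := num_vertices _; set f := num_faces _.
set m := num_edges _; clearbody k v f m; case: k => // k _.
rewrite exprS -mulrA; congr (_ * (_ * (_ ^+ _ * _ ^+ _))); first lia.
by congr _./2; lia.
Qed.

Lemma brt_sum_one_vertex D : num_vertices D = 1%N ->
  brt_sum D = \sum_(E : {set {set T}} | E \subset edges D)
              'X_Y3 ^+ nullity (delete D E) * 'X_Z3 ^+ genus (delete D E).
Proof.
move=> v1; apply: eq_bigr => E _; rewrite /brt_weight.
suff -> : num_components (delete D E) = 1%N by rewrite expr0 mul1r.
have := num_components_le (delete D E); rewrite num_vertices_delete v1.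
suff : (0 < num_components (delete D E))%N by case: num_components => // -[].
rewrite num_components_delete addn_gt0; move/eqP: v1.
rewrite /num_vertices; case: (isolated D) => [|i _]; last by rewrite orbT.
rewrite addn0 orbF !card_gt0 => /eqP v1.
have : porbit (sigma0 D) @: half_edges D != set0 by rewrite -card_gt0 v1.
by rewrite !imset_eq0.
Qed.

End BRTSum.

Lemma brt_sum_invariant (T T' : finType) (D : ribbon T) (D' : ribbon T') :
  ribbon_isomorphic D D' -> brt_sum D = brt_sum D'.
Proof.
case=> f [finj fH f0 f1 iso].
have fe x : x \in half_edges D -> f @: edge_of D x = edge_of D' (f x).
  move=> xD; apply/setP=> y; rewrite mem_edge_of -f1 //; apply/imsetP/orP.
    by case=> z + ->; rewrite mem_edge_of => /orP[] /eqP->; rewrite eqxx;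
      [left|right].
  by case=> /eqP->; [exists x | exists (sigma1 D x)];
    rewrite // mem_edge_of eqxx ?orbT.
have edges_im : edges D' = (fun e : {set T} => f @: e) @: edges D.
  rewrite /edges -fH -!imset_comp; apply: eq_in_imset => x xD.
  by rewrite /= fe.
have einj : {in edges D &, injective (fun e : {set T} => f @: e)}.
  move=> _ _ /imsetP[x xD ->] /imsetP[y yD ->]; rewrite !fe // => /eqP.
  rewrite edge_of_eq -f1 // => /orP[] /eqP/finj-> //;
    rewrite ?sigma1_half_edge //.
  exact: edge_of_sigma1.
rewrite /brt_sum edges_im [RHS](sum_subsets_imset _ einj); apply: eq_bigr =>
  E ED.
set E' := _ @: E.
have kept_f x : x \in half_edges D -> (f x \in kept D' E') = (x \in kept D E).
  move=> xD; rewrite !inE xD -fH imset_f //= -fe //; congr (~~ _).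
  apply/imsetP/idP=> [[e eE /einj->]|xE]; rewrite ?imset_f ?(subsetP ED) //.
  by exists (edge_of D x).
have f1' x : x \in half_edges D -> f (sigma1 (delete D E) x)
  = sigma1 (delete D' E') (f x).
  by move=> xD; rewrite !sigma1_delete kept_f //; case: ifP => // _; rewrite f1.
have H0 x : x \in half_edges D -> sigma0 D x \in half_edges D.
  by rewrite (perm_closed _ (sigma0_on D)).
have H1 x : x \in half_edges D -> sigma1 (delete D E) x \in half_edges D.
  by rewrite sigma1_delete => xD; case: ifP; rewrite ?sigma1_half_edge.
apply: brt_weight_eq.
- rewrite !num_components_delete -iso -fH.
  by rewrite (orb_transport H0 H1 finj f0 f1').
- rewrite !num_vertices_delete /num_vertices -iso -fH !(eq_imset _ (porbit_orb
  _)).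
  by rewrite (orb_transport H0 H0 finj f0 f0).
- rewrite !num_edges_delete //; last by rewrite edges_im imsetS.
  rewrite /num_edges edges_im (card_in_imset einj) (card_in_imset (D := mem E))
    //.
  by move=> e e' eE e'E; apply: einj; apply: (subsetP ED).
rewrite !num_faces_delete -iso -fH !(eq_imset _ (porbit_orb _)).
have H2 x : x \in half_edges D ->
  (sigma1 (delete D E) * sigma0 D)%g x \in half_edges D.
  by move=> xD; rewrite permM H0 // H1.
have f2 x : x \in half_edges D -> f ((sigma1 (delete D E) * sigma0 D)%g x)
    = (sigma1 (delete D' E') * sigma0 D')%g (f x).
  by move=> xD; rewrite !permM f0 ?H1 // f1'.
by rewrite (orb_transport H2 H2 finj f2 f2).
Qed.

Lemma brt_sum_is_BRT : is_BRT brt_sum.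
Proof.
split=> [T T' D D' _|T D h _ hD _|T D h|T D _].
- exact: brt_sum_invariant.
- exact: brt_sum_delete_contract.
- exact: brt_sum_bridge.
exact: brt_sum_one_vertex.
Qed.

(** A connected ribbon graph with several vertices has an edge that is not a
    loop; its contraction is connected, and so is its deletion unless it is a
    bridge. *)
Lemma is_BRT_unique C : is_BRT C ->
  forall (T : finType) (D : ribbon T), ribbon_connected D -> C T D = brt_sum D.
Proof.
move=> CP T D; have [n] := ubnP (num_edges D); elim: n D => // n IHn D;
  rewrite ltnS => Dn cD.
have [v1|v1] := eqVneq (num_vertices D) 1%N.
  by rewrite (BRT_one_vertex CP cD v1) brt_sum_one_vertex.
have [h hD hl] : exists2 h, h \in half_edges D & ~~ is_loop D h.
  apply/exists_inP; rewrite -negb_forall_in; apply: contra v1 =>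
    /forall_inP loops.
  rewrite /num_vertices (eq_in_imset (g := orb (sigma0 D) (sigma1 D))) // =>
    x xD.
  apply/eqP; rewrite eqEsubset porbit_sub_orb /=; apply/subsetP=> y yx.
  suff /andP[] : (y \in half_edges D) && (y \in porbit (sigma0 D) x) by [].
  apply: (@orb_ind _ _ _ (fun w => (w \in half_edges D) && (w \in porbit
    (sigma0 D) x))) yx.
  - by move=> z /andP[zD zx]; rewrite (perm_closed _ (sigma0_on D)) zD
    mem_porbit1.
  - move=> z /andP[zD zx]; rewrite sigma1_half_edge zD /=.
    by have := loops z zD; rewrite /is_loop -!eq_porbit_mem => /eqP->;
      rewrite eq_porbit_mem.
  by rewrite xD porbit_id.
have cc : ribbon_connected (contract D h).
  rewrite /ribbon_connected -num_components_delete0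
    num_components_delete_contract ?inE //.
  by rewrite num_components_delete0.
have nc : (num_edges (contract D h) < n)%N.
  apply: leq_trans Dn; rewrite /num_edges edges_contract [X in (_ <
    X)%N](cardsD1 (edge_of D h)).
  by rewrite imset_f.
have [hb|hb] := boolP (is_bridge D h).
  by rewrite (BRT_bridge CP cD hD hb) (brt_sum_bridge cD hD hb) IHn.
rewrite (BRT_delete_contract CP cD hD hb hl) (brt_sum_delete_contract hD hl).
rewrite [C _ (contract D h)]IHn // IHn //.
move: hb cD; rewrite /is_bridge /ribbon_connected => hb /eqP cD; apply/eqP.
have := @num_components_add_edge _ D set0 h hD; rewrite inE setU0 => /(_ isT).
by rewrite num_components_delete0; case: (_ \in _) => /= E;
  rewrite E ?addn0 // addn1 eqxx in hb *.
Qed.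

Lemma BRT_sumE (T : finType) (D : ribbon T) : ribbon_connected D -> BRT D
  = brt_sum D.
Proof.
apply: is_BRT_unique; apply: epsilon_spec; exists brt_sum.
exact: brt_sum_is_BRT.
Qed.

(** * The state sum for the Kauffman bracket *)

Lemma orb_eq_on (T : finType) (a b b' : {perm T}) x :
  {in orb a b x, b =1 b'} -> orb a b x = orb a b' x.
Proof.
move=> bb'; apply/setP=> y; apply/idP/idP=> yx.
  suff /andP[] : (y \in orb a b x) && (y \in orb a b' x) by [].
  apply: (@orb_ind _ _ _ (fun w => (w \in orb a b x) && (w \in orb a b' x))) yx.
  - by move=> z /andP[zx zx']; rewrite !orb_l zx.
  - by move=> z /andP[zx zx']; rewrite orb_r zx bb' // orb_r.
  by rewrite !orb_refl.
apply: (@orb_ind _ _ _ (fun w => w \in orb a b x)) yx => [z zx|z zx|].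
- by rewrite orb_l.
- by rewrite -bb' // orb_r.
exact: orb_refl.
Qed.

Section States.

Variable X : finType.
Implicit Types (N S : {set X}) (c : X) (L : diagram X) (d : X * 'I_4).

Definition state_strand N S : {perm X * 'I_4} :=
  (strand ASplicing (N :\: S) * strand BSplicing (N :&: S))%g.

Definition state_circ L S : nat :=
  (circles L + #|orb (tau L) (state_strand (crossings L) S) @: darts (crossings
    L)|)%N.

Lemma strandE sp N d : strand sp N d
  = if d.1 \in N then (d.1, partner sp d.2) else d.
Proof. by rewrite permE. Qed.

Lemma strandK sp N : involutive (strand sp N).
Proof. by move=> d; rewrite !permE strand_funK. Qed.

Lemma state_strandE N S d : state_strand N S d =
  if d.1 \in N then (d.1, partner (if d.1 \in S then BSplicing else ASplicing)
    d.2) else d.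
Proof.
rewrite permM !strandE; case: d => c i /=; rewrite !inE.
by case cN: (c \in N); case cS: (c \in S); rewrite /= ?inE ?cN ?cS.
Qed.

Lemma state_strandK N S : involutive (state_strand N S).
Proof.
case=> c i; rewrite !state_strandE /=.
by case cN: (c \in N); rewrite /= cN ?partnerK.
Qed.

Lemma state_strand_on N S : perm_on (darts N) (state_strand N S).
Proof.
apply/subsetP=> d; rewrite !inE state_strandE; case: ifP => //.
by rewrite eqxx.
Qed.

Lemma tau_on L : perm_on (darts (crossings L)) (tau L).
Proof. by case/and3P: (diagramP L). Qed.

Lemma tauK L : involutive (tau L).
Proof. by case/and3P: (diagramP L) => _ /forallP tK _ d; apply/eqP. Qed.

Lemma state_circ_gt0 L S : (0 < state_circ L S)%N
  = (0 < #|crossings L| + circles L)%N.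
Proof.
rewrite /state_circ !addn_gt0 [RHS]orbC !card_gt0 imset_eq0; congr (_ || ~~ _).
apply/eqP/eqP=> [L0|->]; last by apply/setP=> d; rewrite !inE.
apply/setP=> c; have := in_set0 (c, ord0 : 'I_4).
by rewrite -L0 !inE.
Qed.

Section Splice.

Variables (sp : splicing) (L : diagram X) (c : X).
Hypothesis cL : c \in crossings L.

Let N := crossings L.
Let K := darts (N :\ c).
Let p : {perm X * 'I_4} := strand sp [set c].
Let r := walk sp L c.

Variables s s' : {perm X * 'I_4}.
Hypothesis s'K : perm_on K s'.
Hypothesis s_p : {in darts [set c], s =1 p}.
Hypothesis s_s' : forall d, d.1 != c -> s d = s' d.

Lemma walk_tau d : r (tau L d) = p d.
Proof. by rewrite permM tauK. Qed.

Lemma walk_tau_p d : r (tau L (p d)) = d.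
Proof. by rewrite walk_tau strandK. Qed.

Lemma p_out d : d.1 != c -> p d = d.
Proof. by move=> dc; rewrite strandE inE (negPf dc). Qed.

(** A strand of the spliced diagram runs along arcs and along the spliced
    strands at [c] in one direction, which is a cycle of [walk]; the opposite
    direction is covered by conjugating with [tau]. *)
Lemma splice_orbits x y : x \in K -> y \in K ->
  (y \in orb (tau L) s x) = (y \in orb r s' x).
Proof.
move=> xK yK; apply/idP/idP; last first.
  apply/subsetP/orb_sub => z.
    have [zc|zc] := eqVneq (tau L z).1 c.
      by rewrite permM -/p -s_p ?inE ?zc // orb_r orb_l orb_refl.
    by rewrite permM -/p p_out // orb_l orb_refl.
  have [zc|/s_s'<-] := eqVneq z.1 c; last by rewrite orb_r orb_refl.
  by rewrite (out_perm s'K) ?orb_refl // !inE zc eqxx.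
(* The orbit on the left covers O and the strands of O traversed backwards. *)
set O := orb r s' x; pose P w := (w \in O) || (tau L w \in O).
have PK w : w.1 != c -> P w -> w \in O.
  move=> wc /orP[//|]; rewrite -(orb_l r s') walk_tau.
  by rewrite p_out.
move=> yx; apply: (PK); first by move: yK; rewrite !inE => /andP[].
apply: (@orb_ind _ _ _ P) yx => [w|w Pw|]; last by rewrite /P orb_refl.
  by rewrite /P tauK orbC.
have [wc|wc] := eqVneq w.1 c; last by rewrite /P s_s' // orb_r PK.
rewrite s_p ?inE ?wc //; case/orP: Pw => wO; apply/orP.
  by right; rewrite -(orb_l r s') walk_tau_p.
by left; rewrite -walk_tau orb_l.
Qed.

Lemma splice_new_circles :
  [set O in orb (tau L) s @: darts N | [disjoint O & K]] = new_circles sp L c.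
Proof.
have sN : perm_on (darts N) s.
  apply/subsetP=> d; rewrite !inE; apply: contraNT => dN.
  have dc : d.1 != c by apply: contraNneq dN => ->.
  by rewrite s_s' // (out_perm s'K) // !inE (negPf dN) andbF.
have inc (d : X * 'I_4) : d \in darts [set c] = (d.1 == c) by rewrite !inE.
apply/setP=> O; rewrite !inE; apply/andP/andP=> -[/imsetP[x xN ->]] dis.
  have sub : orb (tau L) s x \subset darts [set c].
    apply/subsetP=> y yx; rewrite inc.
    have := orb_stable (tau_on L) sN xN yx; apply: contraTT => yc.
    by apply: contraFN (disjointFr dis yx) => yN; move: yN; rewrite !inE yc.
  have E : orb (tau L) s x = orb (tau L) p x.
    by apply: orb_eq_on => y yx; rewrite s_p // (subsetP sub).
  rewrite E in sub *.
  split=> //; apply: imset_f; apply: (subsetP sub); exact: orb_refl.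
split.
  apply/imsetP; exists x; first by move: xN; rewrite !inE => /eqP->.
  apply: orb_eq_on => y yx; apply/esym/s_p; exact: (subsetP dis).
rewrite disjoint_sym disjoints_subset; apply/subsetP=> y; rewrite !inE =>
  /andP[yc _].
by apply: contraNN yc => /(subsetP dis); rewrite inc.
Qed.

Lemma card_splice_orbits :
  (#|orb (tau (splice sp L c)) s' @: darts (crossings (splice sp L c))|
     + #|new_circles sp L c| = #|orb (tau L) s @: darts N|)%N.
Proof.
have KN : K \subset darts N by apply/subsetP=> d; rewrite !inE => /andP[].
have sN : perm_on (darts N) s.
  apply/subsetP=> d; rewrite !inE; apply: contraNT => dN.
  have dc : d.1 != c by apply: contraNneq dN => ->.
  by rewrite s_s' // (out_perm s'K) // !inE (negPf dN) andbF.
rewrite [RHS](card_orb_meet _ _ K) (orbits_meet (tau_on L) sN KN)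
  splice_new_circles.
congr (_ + _)%N; apply: (@card_imset_transport _ _ _ _ _ _ id) =>
  // [x y xK yK|x xK].
  by rewrite !orbE splice_orbits // [RHS](orb_induced r s'K yK xK).
by exists x.
Qed.

End Splice.

Lemma state_circ_A L c S : c \in crossings L -> S \subset crossings L :\ c ->
  state_circ (splice ASplicing L c) S = state_circ L S.
Proof.
move=> cL; rewrite subsetD1 => /andP[SL cS];
  rewrite /state_circ -addnA [(#|new_circles _ _ _| + _)%N]addnC.
congr (_ + _)%N; apply: card_splice_orbits => //; first exact: state_strand_on.
  move=> [c' i]; rewrite !inE /= => /eqP->.
  by rewrite state_strandE strandE /= inE eqxx cL (negPf cS).
by move=> [c' i] /= cc'; rewrite !state_strandE /= !inE cc'.
Qed.

Lemma state_circ_B L c S : c \in crossings L -> S \subset crossings L :\ c ->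
  state_circ (splice BSplicing L c) S = state_circ L (c |: S).
Proof.
move=> cL SL; rewrite /state_circ -addnA [(#|new_circles _ _ _| + _)%N]addnC.
congr (_ + _)%N; apply: card_splice_orbits => //; first exact: state_strand_on.
  move=> [c' i]; rewrite !inE /= => /eqP->.
  by rewrite state_strandE strandE /= !inE eqxx cL.
by move=> [c' i] /= cc'; rewrite !state_strandE /= !inE cc' (negPf cc').
Qed.

End States.

Definition state_weight (X : finType) (L : diagram X) (S : {set X}) : ratfun :=
  varA ^+ #|crossings L :\: S| * varA^-1 ^+ #|S| * delta ^+ (state_circ L S).-1.

Definition bracket_sum (X : finType) (L : diagram X) : ratfun :=
  \sum_(S : {set X} | S \subset crossings L) state_weight L S.

Lemma bracket_sum_is_bracket : is_bracket bracket_sum.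
Proof.
split=> [X L L0 c1|X L L0|X L c cL].
- rewrite /bracket_sum L0 (big_pred1 set0) => [|S]; last by rewrite subset0.
  rewrite /state_weight L0 setD0 cards0 !mul1r /state_circ c1 L0.
  by rewrite (_ : darts set0 = set0) ?imset0 ?cards0 //; apply/setP=> d;
    rewrite !inE.
- rewrite /bracket_sum mulr_sumr; apply: eq_bigr => S _.
  rewrite /state_weight mulrCA; congr (_ * _).
  have -> : state_circ (add_circle L) S = (state_circ L S).+1 by [].
  by rewrite -exprS prednK // state_circ_gt0.
rewrite {1}/bracket_sum (sum_subsets_setD1 _ cL) !mulr_sumr; congr (_ + _).
  apply: eq_bigr => S SL; rewrite /state_weight state_circ_A // !mulrA -exprS.
  congr (_ ^+ _ * _ * _); rewrite (cardsD1 c) !inE cL.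
  have /negPf-> : c \notin S by move: SL; rewrite subsetD1 => /andP[].
  by rewrite add1n; congr _.+1; apply: eq_card => d; rewrite !inE andbCA.
apply: eq_bigr => S SL; rewrite /state_weight state_circ_B //.
have cS : c \notin S by move: SL; rewrite subsetD1 => /andP[].
rewrite cardsU1 cS exprS !mulrA; congr (_ * _ * _).
rewrite mulrC; congr (_ * _ ^+ _).
by apply: eq_card => d; rewrite !inE negb_or -andbA andbCA.
Qed.

Lemma is_bracket_unique br : is_bracket br ->
  forall (X : finType) (L : diagram X), (0 < #|crossings L| + circles L)%N ->
  br X L = bracket_sum L.
Proof.
move=> brP X L; have sumP := bracket_sum_is_bracket.
have [n] := ubnP #|crossings L|; elim: n L => // n IHn L; rewrite ltnS => Ln L0.
have [N0|[c cL]] := set_0Vmem (crossings L); last first.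
  rewrite (bracket_splice brP cL) (bracket_splice sumP cL).
  have pos sp : (0 < #|crossings (splice sp L c)| + circles (splice sp L c))%N.
    have S0 : set0 \subset crossings L :\ c := sub0set _.
    rewrite -(state_circ_gt0 _ set0).
    by case: sp; rewrite ?(state_circ_A cL S0) ?(state_circ_B cL S0)
      state_circ_gt0.
  by rewrite !IHn //; apply: leq_trans Ln;
    rewrite [X in (_ < X)%N](cardsD1 c) cL.
case: L N0 {Ln} L0 => N t m LP /= N0; subst N; rewrite cards0 add0n.
elim: m LP => // -[|m] IHm LP _.
  by rewrite (bracket_circle brP) // (bracket_circle sumP).
have := bracket_add_circle brP (L := Diagram m.+1 LP); rewrite /add_circle /=.
rewrite cards0 add0n => -> //.
have := bracket_add_circle sumP (L := Diagram m.+1 LP); rewrite /add_circle /=.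
by rewrite cards0 add0n => -> //; rewrite IHm.
Qed.

Lemma bracket_sumE (X : finType) (L : diagram X) :
  (0 < #|crossings L| + circles L)%N -> bracket L = bracket_sum L.
Proof.
apply: is_bracket_unique; apply: epsilon_spec; exists bracket_sum.
exact: bracket_sum_is_bracket.
Qed.

(** * Even subgraphs of a planar graph bound a set of faces *)

Section Incidence.

Variables (T : finType) (H : {set T}) (t : {perm T}).
Hypothesis tK : involutive t.
Hypothesis tH : {in H, forall x, t x \in H}.
Hypothesis t_neq : {in H, forall x, t x != x}.
Implicit Types (s : {perm T}) (x y : T) (Q C : {set T}).

Definition cycles_on s : {set {set T}} := porbit s @: H.

(** The incidence matrix modulo 2 of the graph with the cycles of [s] as
    vertices and those of [t] as edges;
      a loop has two ends at its vertex and gives the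
    entry 0.  For the face permutation this is the dual of the graph given by
    the rotation. *)
Definition incidence s : 'M['F_2]_(#|cycles_on s|, #|cycles_on t|) :=
  \matrix_(i, j) (#|enum_val i :&: enum_val j|)%:R.

Lemma enum_cycle s x (xH : x \in H) : {i : 'I_#|cycles_on s| | enum_val i
  = porbit s x}.
Proof.
have xs : porbit s x \in cycles_on s by exact: imset_f.
by exists (enum_rank_in xs (porbit s x)); rewrite enum_rankK_in.
Qed.

Lemma mem_enum_cycle s (i : 'I_#|cycles_on s|) x :
  (x \in enum_val i) = (enum_val i == porbit s x).
Proof.
have /imsetP[y _ ->] := enum_valP i.
by rewrite eq_porbit_mem porbit_sym.
Qed.

Lemma mem_enum_cycle_perm s (i : 'I_#|cycles_on s|) x :
  (s x \in enum_val i) = (x \in enum_val i).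
Proof. by have /imsetP[y _ ->] := enum_valP i; rewrite mem_porbit1. Qed.

Lemma porbit_arc x : porbit t x = [set x; t x].
Proof.
exact: porbit_involution.
Qed.

Lemma sum_arc (F : T -> 'F_2) x : x \in H -> \sum_(y in porbit t x) F y
  = F x + F (t x).
Proof.
by move=> xH; rewrite porbit_arc big_setU1 ?big_set1 //= inE eq_sym t_neq.
Qed.

Lemma sum_arcs (g : {set T} -> 'F_2) Q : Q \subset H ->
  \sum_(j < #|cycles_on t|) g (enum_val j) * (#|Q :&: enum_val j|)%:R
  = \sum_(x in Q) g (porbit t x).
Proof.
move=> /subsetP QH; transitivity (\sum_j \sum_(x in Q) g (enum_val j) *+
    (x \in enum_val (A := mem (cycles_on t)) j)).
  apply: eq_bigr => j _; rewrite mulr_natr sumrMnr; congr (_ *+ _).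
  by rewrite -sum1_card big_mkcond [RHS]big_mkcond /=; apply: eq_bigr => x _;
    rewrite inE; do 2!case: (x \in _).
rewrite exchange_big; apply: eq_bigr => x /QH xH.
have [j jx] := enum_cycle t xH;
  rewrite (bigD1 j) //= jx porbit_id big1 ?addr0 // => k kj.
rewrite mem_enum_cycle -jx (inj_eq enum_val_inj).
by rewrite (negPf kj).
Qed.

(** A row vector indexed by cycles, seen as a function on points; the sum avoids
    a default index for points that lie on none of the cycles. *)
Definition cycle_val s (u : 'rV['F_2]_#|cycles_on s|) x : 'F_2 :=
  \sum_i u 0 i *+ (x \in enum_val i).

Lemma cycle_valE s u x (i : 'I_#|cycles_on s|) :
  x \in enum_val i -> @cycle_val s u x = u 0 i.
Proof.
move=> xi; rewrite /cycle_val (bigD1 i) //= xi big1 ?addr0 // => k ki.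
move: xi ki; rewrite !mem_enum_cycle => /eqP <-.
by rewrite (inj_eq enum_val_inj) => /negPf->.
Qed.

Lemma cycle_val_perm s u x : @cycle_val s u (s x) = cycle_val u x.
Proof. by apply: eq_bigr => i _; rewrite mem_enum_cycle_perm. Qed.

Lemma mul_incidence s u x (j : 'I_#|cycles_on t|) : x \in H -> enum_val j
  = porbit t x ->
  (u *m incidence s) 0 j = cycle_val u x + cycle_val u (t x).
Proof.
move=> xH jx; rewrite -(sum_arc _ xH) -jx mxE exchange_big;
  apply: eq_bigr => i _.
rewrite mxE mulr_natr sumrMnr; congr (_ *+ _).
by rewrite -sum1_card big_mkcond [RHS]big_mkcond /=; apply: eq_bigr => y _;
  rewrite inE; do 2!case: (y \in _).
Qed.

Lemma F2_addxx (a : 'F_2) : a + a = 0.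
Proof. by apply: val_inj; case: a => -[|[|]]. Qed.

Lemma F2_add_eq0 (a b : 'F_2) : a + b = 0 -> a = b.
Proof. by move=> ab; rewrite -[a]addr0 -(F2_addxx b) addrA ab add0r. Qed.

(** A vector of the left kernel takes the same value at both ends of every edge,
    so that it is constant if the graph is connected. *)
Lemma rank_incidence s : {in H &, forall x y, y \in orb s t x} ->
    {in H, forall x, s x \in H} ->
  (#|cycles_on s| <= (\rank (incidence s)).+1)%N.
Proof.
move=> conn sH; set M := incidence s.
suff : (\rank (kermx M) <= 1)%N.
  by rewrite mxrank_ker leq_subLR addn1.
(* The kernel is contained in the line of the constants. *)
apply: leq_trans (rank_leq_row (const_mx 1 : 'rV['F_2]_#|cycles_on s|)).
apply: mxrankS; apply/row_subP=> k; set u := row k _.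
have uM : u *m M = 0 by apply/sub_kermxP/row_sub.
clearbody u.
have ut x : x \in H -> cycle_val u (t x) = cycle_val u x.
  move=> xH; have [j jx] := enum_cycle t xH.
  by apply/esym/F2_add_eq0; rewrite -(mul_incidence _ xH jx) uM mxE.
have uc x y : x \in H -> y \in H -> cycle_val u x = cycle_val u y.
  move=> xH yH; apply/esym/eqP; have := conn x y xH yH => yx.
  suff /andP[] : (y \in H) && (cycle_val u y == cycle_val u x) by [].
  apply: (@orb_ind _ s t (fun w => (w \in H) && (cycle_val u w == cycle_val u
    x))) yx.
  - by move=> z /andP[zH]; rewrite cycle_val_perm sH.
  - by move=> z /andP[zH]; rewrite ut ?tH.
  by rewrite xH eqxx.
apply/sub_rVP; case: (pickP (fun x => x \in H)) => [x xH|H0].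
  exists (cycle_val u x); apply/rowP=> i; rewrite !mxE mulr1.
  have /imsetP[y yH yi] := enum_valP i.
  by rewrite (uc x y) // (@cycle_valE s u y i) ?yi ?porbit_id //.
exists 0; apply/rowP=> i; have /imsetP[y] := enum_valP i.
by have := H0 y; rewrite /= => ->.
Qed.

Variables (f v : {perm T}).
Hypothesis fH : {in H, forall x, f x \in H}.
Hypothesis vH : {in H, forall x, v x \in H}.
Hypothesis tfv : forall x, t x = v (f x).
Hypothesis f_conn : {in H &, forall x y, y \in orb f t x}.
Hypothesis v_conn : {in H &, forall x y, y \in orb v t x}.
Hypothesis euler : (#|cycles_on v| + #|cycles_on f| = #|cycles_on t| + 2)%N.

Lemma cycle_subset s (sH : {in H, forall x, s x \in H}) (i : 'I_#|cycles_on s|)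
  :
  enum_val i \subset H.
Proof.
have /imsetP[x xH ->] := enum_valP i; apply/subsetP=> y.
exact: (@porbit_ind _ _ (fun w => w \in H)).
Qed.

(** At every dart [x] of a face, the face meets the vertex of [x] and the vertex
    of [t x], which is the one of the next dart [f x]: along the boundary of
    the face every vertex is counted twice. *)
Lemma incidence_boundary : incidence f *m (incidence v)^T = 0.
Proof.
apply/matrixP=> i k; rewrite !mxE.
under eq_bigr => j _ do rewrite !mxE mulrC.
rewrite (sum_arcs (fun b : {set T} =>
  (#|enum_val k :&: b|)%:R)) ?cycle_subset //.
have E x : x \in enum_val i -> (#|enum_val k :&: porbit t x|)%:R
    = (x \in enum_val k)%:R + (f x \in enum_val k)%:R :> 'F_2.
  move=> xi; have xH : x \in H := subsetP (cycle_subset fH i) x xi.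
  rewrite -(mem_enum_cycle_perm k (f x)) -tfv.
  rewrite -(sum_arc (fun y => (y \in enum_val k)%:R) xH) -natr_sum; congr _%:R.
  by rewrite -sum1_card big_mkcond [RHS]big_mkcond /=; apply: eq_bigr => y _;
    rewrite inE; do 2!case: (y \in _).
rewrite (eq_bigr _ E) big_split /=.
rewrite [X in _ + X](_ : _ = \sum_(x in enum_val i) (x \in enum_val k)%:R)
  ?F2_addxx //.
rewrite [RHS](reindex_inj (@perm_inj _ f)) /=.
by apply: eq_bigl => x; rewrite mem_enum_cycle_perm.
Qed.

(** The boundaries of the sets of faces form a space of dimension at least
    [F - 1], the even subgraphs a space of dimension at most [E - V + 1]; by
    Euler's formula these numbers are equal. *)
Lemma even_subgraph_bounds C : {in H, forall x, (t x \in C) = (x \in C)} ->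
    {in H, forall x, ~~ odd #|porbit v x :&: C|} ->
  exists2 chi : T -> bool, {in H, forall x, chi (f x) = chi x}
    & {in H, forall x, chi (t x) = chi x (+) (x \in C)}.
Proof.
move=> Ct Cv; pose w : 'rV['F_2]_#|cycles_on t| := \row_j (enum_val (A := mem
  (cycles_on t)) j \subset C)%:R.
have arcC x : x \in H -> (porbit t x \subset C) = (x \in C).
  move=> xH; rewrite porbit_arc; apply/subsetP/idP=> [|xC y /set2P[]->];
    rewrite ?Ct //.
  by apply; rewrite set21.
have wv : w *m (incidence v)^T = 0.
  apply/rowP=> i; rewrite !mxE; under eq_bigr => j _ do rewrite !mxE.
  rewrite (sum_arcs (fun b : {set T} => (b \subset C)%:R)) ?cycle_subset //.
  have /imsetP[x xH ix] := enum_valP i.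
  transitivity ((#|porbit v x :&: C|)%:R : 'F_2); last first.
    rewrite -[#|_|]odd_double_half (negPf (Cv x xH)) add0n -addnn natrD.
    exact: F2_addxx.
  rewrite ix -natr_sum; congr _%:R;
    rewrite -sum1_card big_mkcond [RHS]big_mkcond /=.
  apply: eq_bigr => y _; rewrite inE; case: ifP => //= yx; rewrite arcC;
    first by case: ifP.
  by apply: (subsetP (cycle_subset vH i)); rewrite ix.
have fker : (incidence f <= kermx (incidence v)^T)%MS.
  by apply/sub_kermxP; exact: incidence_boundary.
have rank_eq : (\rank (kermx (incidence v)^T) <= \rank (incidence f))%N.
  rewrite mxrank_ker mxrank_tr.
  have := rank_incidence v_conn vH; have := rank_incidence f_conn fH.
  move: euler; move: (\rank (incidence v)) (\rank (incidence f)).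
  by move: #|cycles_on v| #|cycles_on f| #|cycles_on t| => *; lia.
have /submxP[u wu] : (w <= incidence f)%MS.
  have [_] := mxrank_leqif_eq fker; rewrite eqn_leq rank_eq andbT.
  rewrite mxrankS // => /esym/eqmxP ->; exact/sub_kermxP.
exists (fun x => cycle_val u x != 0) => x xH; first by rewrite cycle_val_perm.
have [j jx] := enum_cycle t xH.
have := mul_incidence u xH jx; rewrite -wu mxE jx arcC //.
move: (cycle_val u x) (cycle_val u (t x)) => a b.
by case: (x \in C); case: a => -[|[|]] //=; case: b => -[|[|]].
Qed.

End Incidence.

(** * The orientation of the circles of the all-A-splicing *)

Section Rotation.

Variable X : finType.
Implicit Types (d x y : X * 'I_4) (N : {set X}).

Lemma rotationE d : rotation d = (d.1, ordS d.2).
Proof. by rewrite permE. Qed.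

Lemma iter_rotation k d : iter k rotation d = (d.1, iter k (@ordS 4) d.2).
Proof. by elim: k => [|k IHk]; rewrite ?iterS ?IHk ?rotationE //; case: d. Qed.

Lemma val_iter_ordS k (i : 'I_4) : iter k (@ordS 4) i = ((i + k) %% 4)%N :> nat.
Proof.
elim: k => [|k IHk]; first by rewrite addn0 modn_small.
by rewrite iterS /= IHk addnS -addn1 modnDml addn1.
Qed.

Lemma mem_porbit_rotation x y : (y \in porbit rotation x) = (y.1 == x.1).
Proof.
apply/idP/eqP=> [yx|].
  apply/eqP; apply: (@porbit_ind _ _ (fun w => w.1 == x.1)) yx => // z.
  by rewrite rotationE.
case: x y => c i [c' j] /= ->; suff <- : iter (j + (4 - i))%N rotation (c, i)
  = (c, j).
  exact: porbit_iter.
rewrite iter_rotation; congr (_, _); apply: val_inj; rewrite /= val_iter_ordS.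
by rewrite addnCA subnKC ?(ltnW (ltn_ord i)) // modnDr modn_small.
Qed.

Lemma card_rotation_cycles N : #|porbit rotation @: darts N| = #|N|.
Proof.
rewrite -(card_imset N (@set1_inj _)).
apply: (@card_imset_transport _ _ _ _ _ _ fst) => [x y xN yN|x|c cN].
- by rewrite eq_porbit_mem mem_porbit_rotation (inj_eq (@set1_inj _)).
- by rewrite inE.
by exists (c, ord0); rewrite ?inE.
Qed.

Lemma strandA_even N d : d.1 \in N -> ~~ odd d.2 ->
  rotation (strand ASplicing N d) = d.
Proof.
case: d => c i /= cN ev; rewrite strandE rotationE /= cN /=; congr (_, _).
by apply: val_inj; case: i ev => -[|[|[|[|]]]].
Qed.

Lemma odd_strandA N d : d.1 \in N -> odd (strand ASplicing N d).2 = ~~ odd d.2.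
Proof.
case: d => c i /= cN; rewrite strandE /= cN /=.
by case: i => -[|[|[|[|]]]].
Qed.

Lemma odd_rotation d : odd (rotation d).2 = ~~ odd d.2.
Proof. by case: d => c i; rewrite rotationE; case: i => -[|[|[|[|]]]]. Qed.

Lemma rotation4 d : rotation (rotation (rotation (rotation d))) = d.
Proof.
case: d => c i; rewrite !rotationE /=; congr (_, _); apply: val_inj.
by case: i => -[|[|[|[|]]]].
Qed.

End Rotation.

Section Orientation.

Variables (X : finType) (P : diagram X) (outer : {set X * 'I_4}).
Hypothesis hP : connected_plane_diagram P outer.
Implicit Types (d x y : X * 'I_4) (C : {set X * 'I_4}).

Let N := crossings P.
Let H := darts N.
Let t := tau P.
Let f := face_perm P.
Let p : {perm X * 'I_4} := strand ASplicing N.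

Lemma dartE x : (x \in H) = (x.1 \in N). Proof. by rewrite inE. Qed.

Lemma dart_tau x : (t x \in H) = (x \in H).
Proof. by rewrite (perm_closed _ (tau_on P)). Qed.

Lemma dart_strand x : (p x \in H) = (x \in H).
Proof. by rewrite !dartE strandE; case: ifP. Qed.

Lemma dart_rotation x : (rotation x \in H) = (x \in H).
Proof. by rewrite !dartE rotationE. Qed.

Lemma rotation_face x : rotation (f x) = t x.
Proof. by rewrite permM permKV. Qed.

Lemma face_tau_rotation x : f (t (rotation x)) = x.
Proof. by apply: (@perm_inj _ rotation);
  rewrite rotation_face [t (t _)]tauK. Qed.

Lemma dart_face x : (f x \in H) = (x \in H).
Proof. by rewrite -[LHS]dart_rotation rotation_face dart_tau. Qed.

Lemma tau_neq x : x \in H -> t x != x.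
Proof. by case/and3P: (diagramP P) => _ _ /forall_inP; apply. Qed.

Lemma plane_connected : {in H &, forall x y, y \in orb rotation t x}.
Proof.
move=> x y xH yH; case/and3P: hP => /eqP conn _ _; move: conn.
rewrite /diagram_components; set O := _ @: _ => O1.
have xO : orb t rotation x \in O by exact: imset_f.
have yO : orb t rotation y \in O by exact: imset_f.
have /cards1P[o Oo] : #|O| == 1%N.
  rewrite eqn_leq; apply/andP; split; first
    by rewrite -[X in (_ <= X)%N]O1 leq_addr.
  by rewrite card_gt0; apply/set0Pn; exists (orb t rotation x).
move: xO yO; rewrite Oo !inE => /eqP <- /eqP /orb_eqP.
by rewrite setUC.
Qed.

Lemma plane_face_connected : {in H &, forall x y, y \in orb f t x}.
Proof.
move=> x y xH yH; have := plane_connected xH yH; apply/subsetP/orb_sub => z.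
  by rewrite orb_sym -{1}[z]face_tau_rotation orb_l orb_r orb_refl.
by rewrite orb_r orb_refl.
Qed.

Lemma plane_euler x : x \in H ->
  (#|cycles_on H rotation| + #|cycles_on H f| = #|cycles_on H t| + 2)%N.
Proof.
move=> xH; case/and3P: hP => /eqP c1 /eqP + _.
have c0 : circles P = 0%N.
  move: c1; rewrite /diagram_components; case: (circles P) => // n.
  rewrite addnS => -[/eqP]; rewrite addn_eq0 cards_eq0 => /andP[/eqP E _].
  have : orb (tau P) rotation x \in (set0 : {set {set X * 'I_4}}).
    by rewrite -E imset_f.
  by rewrite inE.
by rewrite c1 c0 muln0 addn0 muln1 /cycles_on card_rotation_cycles.
Qed.

Lemma mem_circle_tau C x : C \in state_circles P -> (t x \in C) = (x \in C).
Proof. by case/imsetP=> y _ ->; rewrite [LHS]orb_l. Qed.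

Lemma mem_circle_strand C x : C \in state_circles P -> (p x \in C) = (x \in C).
Proof. by case/imsetP=> y _ ->; rewrite [LHS]orb_r. Qed.

Lemma circle_of_state x : x \in H -> circle_of P x \in state_circles P.
Proof. exact: imset_f. Qed.

Lemma circle_of_refl x : x \in circle_of P x.
Proof. exact: orb_refl. Qed.

Lemma circle_of_mem C x : C \in state_circles P -> x \in C -> C = circle_of P x.
Proof. by case/imsetP=> y _ -> /orb_eqP. Qed.

(** The A-splicing pairs the ends at a crossing, and both ends of a pair are on
    the same circle. *)
Lemma even_circle_vertex C x : C \in state_circles P -> x \in H ->
  ~~ odd #|porbit rotation x :&: C|.
Proof.
move=> Cs; rewrite dartE => xN.
have -> : porbit rotation x :&: C = pair x.1 @: [set i | (x.1, i) \in C].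
  apply/setP=> -[c i]; rewrite inE mem_porbit_rotation /=; apply/andP/imsetP.
    by case=> /eqP-> cC; exists i; rewrite ?inE.
  by case=> j; rewrite inE => jC [-> ->].
rewrite card_imset => [|i j []//]; rewrite -sum1dep_card big_mkcond.
pose F k : nat := (x.1, inord k : 'I_4) \in C.
rewrite (eq_bigr (fun i : 'I_4 => F i)) => [|i _]; last first.
  by rewrite /F inord_val; case: (_ \in C).
have E k : (k < 4)%N -> F (3 - k)%N = F k.
  move=> k4; rewrite /F -[in RHS]mem_circle_strand // strandE /= xN.
  congr (nat_of_bool ((_, _) \in C)); apply: val_inj; rewrite /= !inordK //.
  by rewrite ltnS leq_subr.
rewrite !big_ord_recr big_ord0 /= -(E 2%N) // -(E 3%N) //= add0n.
by case: (F _) (F _) => -[|m]; lia.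
Qed.

Section OneCircle.

Variable C : {set X * 'I_4}.
Hypothesis Cs : C \in state_circles P.

Local Notation conn := (connect (off_circle P C)).

Lemma off_face x : conn x (f x).
Proof. by apply: connect1; rewrite /off_circle eqxx. Qed.

Lemma off_tau x : x \notin C -> conn x (t x).
Proof. by move=> xC; apply: connect1; rewrite /off_circle xC eqxx orbT. Qed.

Lemma off_rotation2 x : ~~ odd x.2 -> conn x (rotation (rotation x)).
Proof. by move=> ev; apply: connect1; rewrite /off_circle ev eqxx !orbT. Qed.

Lemma off_sym : connect_sym (off_circle P C).
Proof.
suff sub x y : conn x y -> conn y x by move=> x y; apply/idP/idP; apply: sub.
rewrite -[conn y x](connect_rev (off_circle P C) x y).
apply: connect_sub => {x y} x y; rewrite /= => xy.
rewrite connect_rev /=; case/or3P: xy =>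
  [/eqP->|/andP[xC /eqP->]|/andP[ev /eqP->]].
- have := fconnect1 f x; rewrite (fconnect_sym (@perm_inj _ f)).
  by apply: connect_sub => u v /eqP<-; apply: off_face.
- by rewrite -{2}[x](tauK P); apply: off_tau; rewrite mem_circle_tau.
rewrite -{2}[x]rotation4; apply: off_rotation2.
by rewrite !odd_rotation negbK.
Qed.

Lemma off_tau_rotation x : conn (t (rotation x)) x.
Proof. by rewrite -{2}[x]face_tau_rotation; apply: off_face. Qed.

(** The A-splicing of a crossing joins the two even corners, and the odd corners
    are the inner sides of the two spliced strands.  So the two sides of a
    strand are continued by the two sides of the arcs at its ends. *)
Lemma off_strand x : x \in H -> conn x (t (p x)) /\ conn (t x) (p x).
Proof.
have even y : y.1 \in N -> ~~ odd y.2 -> conn y (t (p y)) /\ conn (t y) (p y).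
  move=> yN ev; have py := strandA_even yN ev; set z := p y in py *.
  have tz : conn (t y) z by rewrite -{1}py; exact: off_tau_rotation.
  split=> //; pose w := (rotation^-1)%g z.
  have wz : rotation w = z by rewrite permKV.
  rewrite off_sym -wz; apply: connect_trans (off_tau_rotation _) _.
  rewrite -py -wz; apply: off_rotation2.
  by move: ev; rewrite -{1}py -wz !odd_rotation negbK.
rewrite dartE => xN; have [ev|od] := boolP (~~ odd x.2); first exact: even.
have pN : (p x).1 \in N by rewrite -dartE dart_strand dartE.
have [|h1 h2] := even _ pN; first by rewrite odd_strandA // negbK in od *.
by rewrite [p (p x)]strandK in h1 h2; split; rewrite off_sym.
Qed.

(** The set of faces bounded by [C] changes exactly across the arcs of [C].  The
    passage between the two corners joined by the A-splicing crosses both ends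
    of one spliced strand, which are both on [C] or both off [C]. *)
Lemma jordan_separates x : x \in H -> x \in C -> ~~ conn x (t x).
Proof.
move=> xH xC.
have tH : {in H, forall y, t y \in H} by move=> y; rewrite dart_tau.
have fH : {in H, forall y, f y \in H} by move=> y; rewrite dart_face.
have rH : {in H, forall y, rotation y \in H} by move=> y; rewrite dart_rotation.
have Ct : {in H, forall y, (t y \in C) = (y \in C)}.
  by move=> y _; rewrite mem_circle_tau.
have [chi chif chit] := even_subgraph_bounds (tauK P) tH tau_neq fH rH
  (fun y => esym (rotation_face y)) plane_face_connected plane_connected
  (plane_euler xH) Ct (fun y => even_circle_vertex Cs).
have chir y : y \in H -> chi (rotation y) = chi y (+) (rotation y \in C).
  move=> yH; have yrH := rH y yH.
  rewrite -{2}[y]face_tau_rotation chif ?dart_tau // chit // -addbA addbb.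
  by rewrite addbF.
have inv : closed (off_circle P C) [pred y | (y \in H) && (chi y == chi x)].
  apply: (intro_closed off_sym) => u v uv /andP[uH /eqP ux].
  case/or3P: uv => [/eqP->|/andP[uC /eqP->]|/andP[ev /eqP->]].
  - by rewrite inE dart_face uH chif // ux eqxx.
  - by rewrite inE dart_tau uH chit // (negPf uC) addbF ux eqxx.
  rewrite inE !dart_rotation uH /= !chir ?dart_rotation // -addbA.
  have r2N : (rotation (rotation u)).1 \in N by rewrite -dartE !dart_rotation.
  have ev2 : ~~ odd (rotation (rotation u)).2 by rewrite !odd_rotation negbK.
  rewrite -(mem_circle_strand (rotation (rotation u)) Cs).
  rewrite -[p _](permK rotation) strandA_even // permK addbb addbF ux.
  exact: eqxx.
apply/negP=> /(closed_connect inv).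
rewrite [x \in _]inE [t x \in _]inE dart_tau xH eqxx chit // xC addbT /=.
by case: (chi x).
Qed.

(** Along [C] the two sides of its arcs are connected to those of [x].  A path
    from [x] to [y] in the connected diagram may cross [C], but then continues
    on one of these sides. *)
Lemma jordan_two_sides x y : x \in H -> x \in C -> y \in H ->
  conn x y || conn (t x) y.
Proof.
move=> xH xC yH; have CE := circle_of_mem Cs xC.
pose sides z := (conn x z && conn (t x) (t z)) || (conn x (t z) && conn (t x)
  z).
have along z : z \in C -> sides z.
  rewrite CE => zx; suff /andP[] : (z \in H) && sides z by [].
  apply: (@orb_ind _ t p (fun w => (w \in H) && sides w)) zx => [w|w|].
  - by rewrite dart_tau /sides tauK orbC => /andP[-> /=];
    rewrite andbC [_ && conn x _]andbC.
  - case/andP=> wH; rewrite dart_strand wH /=; have [h1 h2] := off_strand wH.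
    case/orP=> /andP[c1 c2]; apply/orP; [right|left].
      by rewrite (connect_trans c1 h1) (connect_trans c2 h2).
    by rewrite (connect_trans c1 h2) (connect_trans c2 h1).
  by rewrite xH /sides !connect0.
pose Q z := conn x z || conn (t x) z.
have Qtau z : Q z -> Q (t z).
  have [zC _|zC] := boolP (z \in C).
    by case/orP: (along z zC) => /andP[c1 c2]; rewrite /Q ?c1 ?c2 ?orbT.
  by case/orP=> c; rewrite /Q (connect_trans c (off_tau zC)) ?orbT.
apply: (@orb_ind _ rotation t Q) (plane_connected xH yH) => [z Qz|z|].
- rewrite -[rotation z](tauK P); apply: Qtau.
  by case/orP: Qz => c; rewrite /Q (connect_trans c) ?orbT // off_sym
    off_tau_rotation.
- exact: Qtau.
by rewrite /Q connect0.
Qed.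

Lemma inside_conn x y : conn x y -> inside P outer C x = inside P outer C y.
Proof.
move=> xy; congr (~~ _); apply: eq_existsb => z.
by rewrite (same_connect off_sym xy).
Qed.

(** Exactly one of the two sides of [x] is connected to the outer face. *)
Lemma inside_tau_flip x : x \in H -> x \in C ->
  inside P outer C (t x) = ~~ inside P outer C x.
Proof.
move=> xH xC; case/and3P: hP => _ _ /implyP oF.
have /imsetP[o oH oE] : outer \in faces P.
  by apply: oF; apply/set0Pn; exists x.1; rewrite -dartE.
have out z : inside P outer C z = ~~ conn z o.
  congr (~~ _); apply/exists_inP/idP=> [[w wo zw]|zo]; last first.
    by exists o; rewrite // oE porbit_id.
  apply: connect_trans zw _; rewrite off_sym; move: wo;
    rewrite oE porbit_fconnect.
  by apply: connect_sub => u v /eqP<-; apply: off_face.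
rewrite !out negbK; have := jordan_two_sides xH xC oH.
case xo: (conn x o) => /=; last by move->.
move=> _; apply: contra (jordan_separates xH xC) => to.
by apply: connect_trans xo _; rewrite off_sym.
Qed.

(** A circle does not cross the other ones. *)
Lemma inside_along x y : x \in H -> x \notin C -> y \in circle_of P x ->
  inside P outer C y = inside P outer C x.
Proof.
move=> xH xC yx; suff /and3P[_ _ /eqP] :
  [&& y \in H, y \notin C & inside P outer C y == inside P outer C x] by [].
apply: (@orb_ind _ t p (fun w =>
  [&& w \in H, w \notin C & inside P outer C w == inside P outer C x])) yx =>
    [w|w|].
- case/and3P=> wH wC /eqP <-; rewrite dart_tau mem_circle_tau // wH wC /=.
  by apply/eqP/esym/inside_conn/off_tau.
- case/and3P=> wH wC /eqP <-; rewrite dart_strand mem_circle_strand // wH wC /=.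
  apply/eqP/esym/inside_conn; apply: connect_trans (off_tau wC) _.
  by have [] := off_strand wH.
by rewrite xH xC eqxx.
Qed.

End OneCircle.

(** The circle through [x] does not cross the other ones, so that its depth is
    the number of other circles around [x]. *)
Lemma outgoingE x : x \in H ->
  outgoing P outer x = odd #|[set C in state_circles P | inside P outer C x]|.
Proof.
move=> xH; set C0 := circle_of P x; have C0s := circle_of_state xH.
rewrite /outgoing -/C0 /depth [in RHS](cardsD1 C0) inE C0s /= oddD oddb;
  congr (_ (+) odd _).
apply: eq_card => C; rewrite !inE andbCA; case Cs: (C \in _) => //=.
case: eqVneq => //= CC0; have xC : x \notin C.
  by apply: contraNN CC0 => /(circle_of_mem Cs)->.
apply/forall_inP/idP=> [|ins y yC0]; first by apply; exact: circle_of_refl.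
by rewrite (inside_along Cs xH xC).
Qed.

(** The number of circles around a corner changes by one across an arc, and is
    constant on faces: [outgoing] is a checkerboard colouring of the faces. *)
Lemma outgoing_tau x : x \in H -> outgoing P outer (t x)
  = ~~ outgoing P outer x.
Proof.
move=> xH; rewrite !outgoingE ?dart_tau //; set C0 := circle_of P x.
have C0s := circle_of_state xH; have xC0 := circle_of_refl x.
rewrite (cardsD1 C0) [in RHS](cardsD1 C0) !(inE, C0s) /= (inside_tau_flip C0s)
  //.
rewrite !oddD !oddb -addNb; congr (_ (+) odd _).
apply: eq_card => C; rewrite !inE; case: eqVneq => //= CC0.
case Cs: (C \in _) => //=; have xC : x \notin C.
  by apply: contraNN CC0 => /(circle_of_mem Cs)->.
by rewrite (inside_conn Cs (off_tau xC)).
Qed.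

Lemma outgoing_rotation x : x \in H -> outgoing P outer (rotation x)
  = ~~ outgoing P outer x.
Proof.
move=> xH; have rH : rotation x \in H by rewrite dart_rotation.
rewrite -[LHS]negbK -outgoing_tau //; congr (~~ _);
  rewrite !outgoingE ?dart_tau //.
congr odd; apply: eq_card => C; rewrite !inE; case Cs: (C \in _) => //=.
by rewrite (inside_conn Cs (off_tau_rotation _ x)).
Qed.

End Orientation.

(** * States of the diagram and spanning subgraphs of the ribbon graph *)

(** Two involutions that exchange the two classes of a bipartition generate
    orbits that their product traverses on either class. *)
Lemma card_orb_bipartite (T : finType) (a b : {perm T}) (H : {set T}) (o : pred
  T) :
  involutive a -> involutive b ->
  {in H, forall x, a x \in H} -> {in H, forall x, b x \in H} ->
  {in H, forall x, o (a x) = ~~ o x} -> {in H, forall x, o (b x) = ~~ o x} ->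
  #|porbit (a * b)%g @: [set x in H | o x]| = #|orb a b @: H|.
Proof.
move=> aK bK aH bH oa ob.
apply: (@card_imset_transport _ _ _ _ _ _ id) => /= [x y|x|y yH]; last 2 first.
- by rewrite inE => /andP[].
- case oy: (o y); first by exists y; rewrite // inE yH.
  by exists (a y); rewrite ?inE ?aH ?oa ?oy //; apply/orb_eqP;
    rewrite orb_l orb_refl.
rewrite !inE => /andP[xH ox] /andP[yH oy]; rewrite eq_porbit_mem orbE.
apply/idP/idP=> [/(subsetP (porbit_mul_sub_orb b a y))|xy]; first
  by rewrite setUC.
pose r := (a * b)%g; pose P z := (z \in H) && ((if o z then z else a z) \in
  porbit r y).
have : P x; last by rewrite /P ox => /andP[].
apply: (@orb_ind _ a b P) xy => [z|z|]; last by rewrite /P oy yH porbit_id.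
  by rewrite /P => /andP[zH]; rewrite aH // oa //; case: (o z); rewrite /= ?aK.
rewrite /P => /andP[zH]; rewrite bH // ob //; case: (o z) => /= zy; last first.
  by rewrite -[b z](congr1 b (aK z)) -permM mem_porbit1.
by rewrite -mem_porbit1 permM aK bK.
Qed.

Section AllARibbon.

Variables (X : finType) (P : diagram X) (outer : {set X * 'I_4}).
Hypothesis hP : connected_plane_diagram P outer.

Let N := crossings P.
Let H := darts N.
Let t := tau P.
Let p : {perm X * 'I_4} := strand ASplicing N.
Let D := all_A_ribbon P outer.
Let out := outgoing P outer.
Let exit := exit_dart P outer.

Implicit Types (d x y : X * 'I_4) (h : X * bool) (R : {set X}).

Lemma outgoing_strand x : x \in H -> out (p x) = ~~ out x.
Proof.
have even y : y \in H -> ~~ odd y.2 -> out (p y) = ~~ out y.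
  move=> yH ev; rewrite dartE in yH.
  rewrite -{2}[y](strandA_even yH ev) /out outgoing_rotation ?negbK //.
  by rewrite dart_strand dartE.
move=> xH; have [ev|od] := boolP (~~ odd x.2); first exact: even.
have := even (p x); rewrite dart_strand odd_strandA -?dartE // => /(_ xH od).
by rewrite [p (p x)]strandK => ->; rewrite negbK.
Qed.

Lemma outgoing_rotation2 x : x \in H -> out (rotation (rotation x)) = out x.
Proof. by move=> xH; rewrite /out !(outgoing_rotation hP) ?dart_rotation
  ?negbK. Qed.

Lemma half_edge_at_strand x : x \in H -> half_edge_at (p x) = half_edge_at x.
Proof.
case: x => c i; rewrite dartE /= => cN; rewrite strandE /= cN /half_edge_at /=.
by congr (_, _); case: i => -[|[|[|[|]]]].
Qed.

Lemma exit_half_edge_at x : x \in H -> out x -> exit (half_edge_at x) = x.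
Proof.
move=> xH ox; rewrite /exit /exit_dart /=; set b := (x.1, _).
have /orP[/eqP->|/eqP->] : (b == x) || (b == p x).
- rewrite /b; case: x xH {b ox} => c i; rewrite dartE /= => cN.
  rewrite strandE /= cN !xpair_eqE !eqxx /=.
  by case: i => -[|[|[|[|]]]].
- by rewrite -/out ox.
by rewrite -/out outgoing_strand // ox strandK.
Qed.

Lemma exit_half_edge_at_in x : x \in H -> ~~ out x -> exit (half_edge_at x)
  = p x.
Proof.
move=> xH ox; rewrite -half_edge_at_strand // exit_half_edge_at ?dart_strand //.
by rewrite outgoing_strand.
Qed.

Lemma exitP h : h.1 \in N -> [/\ exit h \in H, out (exit h) & half_edge_at
  (exit h) = h].
Proof.
move=> hN; rewrite /exit /exit_dart; set b := (h.1, _).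
have bH : b \in H by rewrite dartE.
have bh : half_edge_at b = h by case: h {hN} @b {bH} => c [].
by rewrite -/out -/p; case: ifP => [//|/negbT ob]; split;
  rewrite ?dart_strand ?outgoing_strand ?half_edge_at_strand.
Qed.

Lemma exit_next h : h.1 \in N -> exit (next_half_edge P outer h)
  = p (t (exit h)).
Proof.
move=> hN; have [eH eo _] := exitP hN.
rewrite /next_half_edge hN exit_half_edge_at_in ?dart_tau //.
by rewrite /out (outgoing_tau hP) // negbK.
Qed.

Lemma next_half_edge_crossing h : (next_half_edge P outer h).1 \in N
  = (h.1 \in N).
Proof.
rewrite /next_half_edge; case: ifP => // hN.
by have [eH _ _] := exitP hN; rewrite /= -dartE dart_tau eH.
Qed.

Lemma next_half_edge_inj : injective (next_half_edge P outer).
Proof.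
move=> h h' E; have := next_half_edge_crossing h;
  rewrite E next_half_edge_crossing.
case hN: (h.1 \in N) => h'N; last by move: E;
  rewrite /next_half_edge -/N hN h'N.
have := exit_next hN; rewrite E exit_next // => /perm_inj/perm_inj eE.
by have [_ _ <-] := exitP hN; have [_ _ <-] := exitP h'N; rewrite eE.
Qed.

Lemma all_A_sigma0E h : sigma0 D h = next_half_edge P outer h.
Proof.
have inj : injectiveb [ffun h => next_half_edge P outer h].
  by apply/injectiveP=> h1 h2; rewrite !ffunE => /next_half_edge_inj.
by rewrite /= -pvalE /all_A_sigma0 [pval _]insubdK // ffunE.
Qed.

Lemma all_A_sigma1E h : sigma1 D h = opposite P h.
Proof. by rewrite permE. Qed.

Lemma all_A_half_edgeE h : (h \in half_edges D) = (h.1 \in N).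
Proof. by rewrite inE. Qed.

Lemma exit_opposite h : h.1 \in N -> exit (opposite P h)
  = rotation (rotation (exit h)).
Proof.
move=> hN; have [eH eo eh] := exitP hN.
rewrite -[RHS]exit_half_edge_at ?dart_rotation ?outgoing_rotation2 //;
  congr exit.
rewrite -{1}eh; case: (exit h) eH => c i; rewrite dartE /= => cN.
rewrite /opposite /= cN addbT !rotationE /half_edge_at /=; congr (_, _).
by case: i => -[|[|[|[|]]]].
Qed.

Definition crossing_edge (c : X) : {set X * bool} := edge_of D (c, false).

Lemma edge_of_crossing h : h.1 \in N -> edge_of D h = crossing_edge h.1.
Proof.
case: h => c [] //= cN; apply/eqP;
  rewrite edge_of_eq all_A_sigma1E /opposite /=.
by rewrite cN eqxx orbT.
Qed.

Lemma edges_all_A : edges D = crossing_edge @: N.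
Proof.
apply/setP=> e; apply/imsetP/imsetP=> [[h]|[c cN ->]].
  by rewrite all_A_half_edgeE => hN ->; exists h.1; rewrite ?edge_of_crossing.
by exists (c, false); rewrite ?all_A_half_edgeE.
Qed.

Lemma crossing_edge_inj : injective crossing_edge.
Proof.
move=> c c' /eqP; rewrite edge_of_eq all_A_sigma1E /opposite /=.
by case/orP=> /eqP[].
Qed.

Lemma sigma1_delete_crossings R h : h.1 \in N ->
  sigma1 (delete D (crossing_edge @: R)) h
  = if h.1 \in N :\: R then opposite P h else h.
Proof.
move=> hN; rewrite sigma1_delete inE all_A_half_edgeE hN edge_of_crossing //.
by rewrite mem_imset ?inE ?hN ?andbT -?all_A_sigma1E //;
  apply: crossing_edge_inj.
Qed.

(** Every A-spliced strand has exactly one outgoing dart, so that the half-edges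
    correspond to the outgoing darts; [sigma0] becomes an arc followed by an
    A-spliced strand, and [sigma1] turns A-spliced strands into B-spliced
    ones. *)
Lemma num_faces_state R : R \subset N ->
  num_faces (delete D (crossing_edge @: R)) = state_circ P (N :\: R).
Proof.
move=> RN; set S := N :\: R; set s1 := sigma1 (delete D (crossing_edge @: R)).
have s1E h : h.1 \in N -> s1 h = if h.1 \in S then opposite P h else h.
  exact: sigma1_delete_crossings.
have s1N h : h.1 \in N -> (s1 h).1 \in N by move=> hN; rewrite s1E //;
  case: ifP.
have s0N h : (sigma0 D h).1 \in N = (h.1 \in N).
  by rewrite all_A_sigma0E next_half_edge_crossing.
have stE x : x \in H -> state_strand N S x =
    if x.1 \in S then rotation (rotation (p x)) else p x.
  case: x => c i; rewrite dartE /= => cN; rewrite state_strandE strandE /= cN.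
  case: ifP => // _; rewrite !rotationE /=; congr (_, _); apply: val_inj.
  by case: i => -[|[|[|[|]]]].
have stH x : x \in H -> state_strand N S x \in H.
  by move=> xH; rewrite stE //; case: ifP; rewrite ?dart_rotation dart_strand.
rewrite num_faces_delete -/s1 /state_circ addnC; congr (_ + _)%N.
rewrite -(@card_orb_bipartite _ _ _ _ out (tauK P) (@state_strandK _ N S));
  first last.
- move=> x xH; rewrite stE //.
  by case: ifP; rewrite ?outgoing_rotation2 ?dart_strand // outgoing_strand.
- by move=> x xH; rewrite /out (outgoing_tau hP).
- exact: stH.
- by move=> x xH; rewrite dart_tau.
(* A face passes through s1 h after h, and leaves the crossing from there. *)
pose g h := exit (s1 h).
have exit1 h : h.1 \in N ->
    g h = if h.1 \in S then rotation (rotation (exit h)) else exit h.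
  by move=> hN; rewrite /g s1E //; case: ifP => // _; rewrite exit_opposite.
have gD : g @: half_edges D = [set x in H | out x].
  apply/setP=> x; rewrite inE; apply/imsetP/andP=> [[h]|[xH ox]].
    rewrite all_A_half_edgeE => hN ->; have [] := exitP (s1N h hN); by [].
  have xN : (half_edge_at x).1 \in N by rewrite -dartE.
  exists (s1 (half_edge_at x)); first by rewrite all_A_half_edgeE s1N.
  by rewrite /g [s1 (s1 _)]sigma1K exit_half_edge_at.
rewrite -gD !(eq_imset _ (porbit_orb _)).
have aH h : h \in half_edges D -> (s1 * sigma0 D)%g h \in half_edges D.
  by rewrite !all_A_half_edgeE permM s0N; apply: s1N.
have ga h : h \in half_edges D ->
    g ((s1 * sigma0 D)%g h) = (t * state_strand N S)%g (g h).
  rewrite all_A_half_edgeE (permM s1) (permM t) => /s1N; rewrite [g h]/g;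
    set y := s1 h => yN.
  have [eH eo eh] := exitP yN.
  rewrite exit1 ?s0N // all_A_sigma0E exit_next // stE ?dart_tau //.
  suff -> : (next_half_edge P outer y).1 = (t (exit y)).1 by [].
  by rewrite /next_half_edge -/N yN.
apply: orb_transport => // h h'; rewrite !all_A_half_edgeE => hN h'N E.
apply: (@perm_inj _ s1); have [_ _ <-] := exitP (s1N h hN).
by have [_ _ <-] := exitP (s1N h' h'N); rewrite -/(g h) E.
Qed.

Lemma plane_nonempty : (0 < #|N| + circles P)%N.
Proof.
have /and3P[/eqP c1 _ _] := hP; rewrite lt0n addn_eq0 cards_eq0;
  apply/negP=> /andP[/eqP N0 /eqP c0].
move: c1; rewrite /diagram_components c0 -/N N0 addn0.
by rewrite (_ : darts set0 = set0) ?imset0 ?cards0 //; apply/setP=> d;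
  rewrite !inE.
Qed.

(** The half-edges at two neighbouring ends of a crossing are equal or opposite,
    and an arc leads from the half-edge at its outgoing end to the next
    half-edge, so that the connectedness of the diagram is inherited. *)
Lemma all_A_connected : ribbon_connected D.
Proof.
have link x y : x \in H -> y \in H ->
    half_edge_at y \in orb (sigma0 D) (sigma1 D) (half_edge_at x).
  move=> xH yH; pose Q z := (z \in H) &&
    (half_edge_at z \in orb (sigma0 D) (sigma1 D) (half_edge_at x)).
  suff /andP[] : Q y by [].
  have s0_out z : z \in H -> out z -> sigma0 D (half_edge_at z)
    = half_edge_at (t z).
    move=> zH oz; rewrite all_A_sigma0E /next_half_edge /= -/exit.
    by rewrite exit_half_edge_at // -dartE zH.
  apply: (@orb_ind _ rotation t Q) (plane_connected hP xH yH) => [z|z|].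
  - case/andP=> zH zx; rewrite /Q dart_rotation zH /=.
    have [->//|->] : half_edge_at (rotation z) = half_edge_at z
        \/ half_edge_at (rotation z) = sigma1 D (half_edge_at z).
      rewrite all_A_sigma1E /opposite /=; case: z zH {zx} => c i;
        rewrite dartE /= => ->.
      by rewrite rotationE /half_edge_at /=;
        case: i => -[|[|[|[|//]]]] ii; [right|left|right|left]; congr (_, _).
    by rewrite orb_r.
  - case/andP=> zH zx; rewrite /Q dart_tau zH /=.
    case oz: (out z); first by rewrite -s0_out // orb_l.
    rewrite -(orb_l (sigma0 D)) s0_out ?dart_tau //; last first.
      by rewrite /out (outgoing_tau hP) // -/out oz.
    by rewrite [t (t z)]tauK.
  by rewrite /Q xH orb_refl.
have c1 : num_components D = diagram_components P.
  congr (_ + _)%N; apply: (@card_imset_transport _ _ _ _ _ _ exit) =>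
    [h h'|h|y yH].
  - rewrite !all_A_half_edgeE => hN h'N; have [eH _ eh] := exitP hN.
    have [eH' _ eh'] := exitP h'N; rewrite !orbE.
    have -> : h \in orb (sigma0 D) (sigma1 D) h' by rewrite -eh -eh' link.
    by have := plane_connected hP eH' eH; rewrite setUC => ->.
  - by rewrite all_A_half_edgeE => /exitP[].
  have yN : (half_edge_at y).1 \in N by rewrite -dartE.
  exists (half_edge_at y); first by rewrite all_A_half_edgeE.
  apply/orb_eqP; have [eH _ _] := exitP yN.
  by have := plane_connected hP yH eH; rewrite setUC.
by rewrite /ribbon_connected c1; case/and3P: hP.
Qed.

End AllARibbon.

(** * Evaluation *)

Lemma varA_neq0 : varA != 0.
Proof. by rewrite tofrac_eq0 polyX_eq0. Qed.

Lemma mul_sqr_delta (F : fieldType) (a : F) : a != 0 ->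
  a ^+ 2 * (- a ^+ 2 - a ^- 2) = - a ^+ 4 - 1.
Proof. by move=> a0; rewrite mulrBr mulrN -exprD divff // expf_neq0. Qed.

Lemma varA2_delta : varA ^+ 2 * delta = - varA ^+ 4 - 1.
Proof. exact: mul_sqr_delta varA_neq0. Qed.

Lemma delta_neq0 : delta != 0.
Proof.
apply/eqP=> d0; have := varA2_delta; rewrite d0 mulr0.
have -> : - varA ^+ 4 - 1 = tofrac (- 'X^4 - 1 : {poly int}).
  by rewrite tofracB tofracN tofracXn tofrac1.
move/esym/eqP; rewrite tofrac_eq0 => /eqP/(congr1 (fun q : {poly int} =>
  q.[0])).
by rewrite !hornerE.
Qed.

Section Eval3.

Variables x y z : ratfun.

Lemma eval3_sum (I : finType) (Q : pred I) (F : I -> {mpoly int[3]}) :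
  eval3 (\sum_(i | Q i) F i) x y z = \sum_(i | Q i) eval3 (F i) x y z.
Proof. by rewrite /eval3 (raddf_sum (map_mpoly intr)) raddf_sum. Qed.

Lemma eval3_weight (T : finType) (D : ribbon T) : eval3 (brt_weight D) x y z
  = (x - 1) ^+ (num_components D).-1 * (y ^+ nullity D * z ^+ genus D).
Proof.
rewrite /eval3 /brt_weight.
rewrite !(rmorphM (map_mpoly intr)) !(rmorphXn (map_mpoly intr)).
rewrite (rmorphB (map_mpoly intr)) (rmorph1 (map_mpoly intr)) /= !map_mpolyX.
set e := fun i => _; rewrite !(rmorphM (meval e)) !(rmorphXn (meval e)).
rewrite (rmorphB (meval e)) (rmorph1 (meval e)) /= !mevalXU.
by rewrite /e !(tnth_nth 0).
Qed.

End Eval3.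

(** Both sides are [a^(- 2 m) d^(f - 1)].  On the right-hand side [X - 1] is
    [a^2 d], and the exponent of [d] becomes
    [(k - 1) + n - 2 g = f - 1], where [n = m + k - v] is the nullity. *)
Lemma weight_identity (F : fieldType) (a d : F) (e v k m f g : nat) :
    a != 0 -> d != 0 -> a ^+ 2 * d = - a ^+ 4 - 1 ->
    (0 < k)%N -> (0 < v)%N -> (0 < f)%N -> (m <= e)%N ->
    (v <= m + k)%N -> (v + f + g.*2 = k * 2 + m)%N ->
  a ^- e * (a ^+ (e - m) * a^-1 ^+ m * d ^+ f.-1)
  = a ^ (2 - 2 * Posz v) *
    ((- a ^+ 4 - 1) ^+ k.-1
       * ((a ^- 2 * d) ^+ (m + k - v) * (d ^- 2) ^+ g)).
Proof.
move=> a0 d0 <- k0 v0 f0 me vk E.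
have -> : a ^ (2 - 2 * Posz v) = a ^- (2 * v.-1).
  by rewrite (_ : 2 - 2 * Posz v = - Posz (2 * v.-1)%N) -?exprnN //; lia.
have -> : a ^- e = (a ^+ (e - m) * a ^+ m)^-1 by rewrite -exprD subnK.
rewrite !exprMn !exprVn -!exprM.
set b := (2 * v.-1)%N; set n := (m + k - v)%N.
have eA : (b + 2 * n = k.-1 + k.-1 + (m + m))%N by rewrite /b /n; lia.
have eD : (f.-1 + 2 * g = k.-1 + n)%N by rewrite /n; lia.
move: b n (2 * n)%N (2 * g)%N eA eD => b n n2 g2 eA eD.
(* Clear all denominators. *)
apply: (mulfI (expf_neq0 (m + m + b + n2)%N a0)).
apply: (mulfI (expf_neq0 g2 d0)).
transitivity (a ^+ (b + n2) * d ^+ (f.-1 + g2)).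
  by rewrite !exprD; field; rewrite !expf_neq0.
by rewrite eA eD !exprD; field; rewrite !expf_neq0.
Qed.

Theorem theorem5p4 (X : finType) (P : diagram X) (outer : {set X * 'I_4})
    (hP : connected_plane_diagram P outer) :
  varA ^- num_edges (all_A_ribbon P outer) * bracket P =
  varA ^ (2 - 2 * Posz (num_vertices (all_A_ribbon P outer))) *
  eval3 (BRT (all_A_ribbon P outer)) (- varA ^+ 4) (varA ^- 2 * delta) (delta
    ^- 2).
Proof.
set D := all_A_ribbon P outer; set N := crossings P.
have edgesE : edges D = crossing_edge P outer @: N := edges_all_A P outer.
have einj := @crossing_edge_inj _ P outer.
have cD : ribbon_connected D := all_A_connected hP.
have v0 : (0 < num_vertices D)%N.
  by apply: leq_trans (num_components_le D); rewrite (eqP cD).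
have eN : num_edges D = #|N| by rewrite /num_edges edgesE card_imset.
rewrite bracket_sumE ?(plane_nonempty hP) // BRT_sumE // /brt_sum /bracket_sum.
rewrite eval3_sum edgesE (sum_subsets_imset _ (in2W einj)).
rewrite [X in _ * X = _]sum_subsets_compl !mulr_sumr; apply: eq_bigr => R RN.
set E := _ @: R; have ED : E \subset edges D by rewrite edgesE imsetS.
have [vk [g eu]] := ribbon_euler ED.
have cE : #|E| = #|R| by rewrite card_imset.
have fE : num_faces (delete D E)
  = state_circ P (N :\: R) := num_faces_state hP RN.
have f0 : (0 < num_faces (delete D E))%N
  by rewrite fE state_circ_gt0 (plane_nonempty hP).
have k0 : (0 < num_components (delete D E))%N.
  rewrite num_components_delete addn_gt0; move: v0;
    rewrite /num_vertices addn_gt0.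
  by rewrite !card_gt0 !imset_eq0.
rewrite eval3_weight /state_weight -fE setDDr setDv set0U (setIidPr RN) cardsD
  (setIidPr RN).
rewrite /nullity /genus num_vertices_delete num_edges_delete // cE eN.
rewrite cE eN in vk eu; have RN' : (#|R| <= #|N|)%N := subset_leq_card RN.
set k := num_components _ in vk eu k0 *; set v := num_vertices _ in v0 vk eu *.
set f := num_faces _ in f0 eu *.
have -> : ((2 * k + (#|N| - #|R|) - (v + f))./2 = g)%N by lia.
have mE : (#|N| - #|R| <= #|N|)%N := leq_subr _ _.
rewrite -(weight_identity varA_neq0 delta_neq0 varA2_delta k0 v0 f0 mE vk eu).
by rewrite subKn.
Qed.
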